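(* Let $G$ be a torsionfree discrete countable group such that every non-zero element of $\mathbb Z G$ acts without kernel on $\ell^2 G$. Assume that $a_1,\dots,a_n \in G$ generate $G$ and that $\lceil \beta^{(2)}_{1}(G) \rceil \geq k$, where $k \geq 0$ is an integer. Then there exist $k+1$ elements $a_{i_0}, \dots, a_{i_k}$ among the generators such that the natural map $$\pi \colon F_{k+1} \to \langle a_{i_0}, \dots, a_{i_k} \rangle \subset G,$$ sending the free generators of the free group $F_{k+1}$ of rank $k+1$ to $a_{i_0},\dots,a_{i_k}$, is an isomorphism.
   Context: $\mathbb Z G$ acts on the Hilbert space $\ell^2 G$ via the linear extension of the left regular representation; ''without kernel'' means injectively. $\lceil x\rceil$ is the least integer $\ge x$. $\beta_1^{(2)}(G)=\dim_{LG}H_1(G;LG)$ is the first $\ell^2$-Betti number, where $LG$ is the group von Neumann algebra and $\dim_{LG}$ is Lück's dimension function.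
   Formalization: For k = 0 the group G is additionally assumed to be non-trivial: for the trivial group all hypotheses hold with k = 0, but no generator generates a free group of rank 1. *)

(* Defs.v *)
From HB Require Import structures.
From mathcomp Require Import all_boot all_order all_algebra.
From mathcomp Require Import finmap complex lra.
From mathcomp Require Import boolp classical_sets functions cardinality fsbigop.
From mathcomp Require Import reals ereal esum.

Set Implicit Arguments.
Unset Strict Implicit.
Unset Printing Implicit Defensive.

Import Order.TTheory GRing.Theory Num.Theory.
Import ComplexField.Normc.

Local Open Scope classical_set_scope.
Local Open Scope ring_scope.
Local Open Scope quotient_scope.

Definition torsion_free (G : groupType) : Prop :=
  forall (g : G) (m : nat), (0 < m)%N -> (g ^+ m)%g = 1%g -> g = 1%g.

Definition is_subgroup (G : groupType) (H : set G) : Prop :=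
  [/\ H 1%g, forall x y, H x -> H y -> H (x * y)%g
    & forall x, H x -> H (x^-1)%g].

Definition subgroup_gen (G : groupType) (A : set G) : set G :=
  smallest (@is_subgroup G) A.

Section FreeGroup.
Variable X : choiceType.

(* The letter [(x, true)] stands for [x] and [(x, false)] for its inverse. *)
Definition word := seq (X * bool).

Definition letter_inv (l : X * bool) : X * bool := (l.1, ~~ l.2).

Inductive word_equiv : word -> word -> Prop :=
| word_equiv_cancel u l v : word_equiv (u ++ l :: letter_inv l :: v) (u ++ v)
| word_equiv_refl u : word_equiv u u
| word_equiv_sym u v : word_equiv u v -> word_equiv v u
| word_equiv_trans u v w : word_equiv u v -> word_equiv v w -> word_equiv u w.

Definition word_eqb (u v : word) : bool := `[< word_equiv u v >].

Lemma word_eqb_is_equiv : equiv_class_of word_eqb.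
Proof.
split=> [u|u v|v u w].
- exact/asboolP/word_equiv_refl.
- by apply/asboolP/asboolP; apply: word_equiv_sym.
- by move=> /asboolP uv /asboolP vw; apply/asboolP/(word_equiv_trans uv vw).
Qed.

Canonical word_equiv_equiv := EquivRelPack word_eqb_is_equiv.
Canonical word_equiv_encModRel := defaultEncModRel word_eqb.

Definition free_group := {eq_quot word_eqb}.

HB.instance Definition _ : EqQuotient word word_eqb free_group :=
  EqQuotient.on free_group.
HB.instance Definition _ := Choice.on free_group.

Lemma free_piP (u v : word) :
  \pi_free_group u = \pi_free_group v <-> word_equiv u v.
Proof.
split=> [/eqP|uv]; first by rewrite piE => /asboolP.
by apply/eqP; rewrite piE; apply/asboolP.
Qed.

Lemma free_reprP (u : word) : word_equiv (repr (\pi_free_group u)) u.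
Proof. by apply/free_piP; rewrite reprK. Qed.

Definition word_inv (u : word) : word := rev (map letter_inv u).

Definition free_one : free_group := \pi_free_group [::].
Definition free_mul (x y : free_group) : free_group := \pi_free_group (repr x ++ repr y).
Definition free_inv (x : free_group) : free_group := \pi_free_group (word_inv (repr x)).
Definition free_gen (x : X) : free_group := \pi_free_group [:: (x, true)].

Lemma letter_invK : involutive letter_inv.
Proof. by case=> x b; rewrite /letter_inv negbK. Qed.

Lemma word_invK : involutive word_inv.
Proof. by move=> u; rewrite /word_inv map_rev revK mapK //; exact: letter_invK. Qed.

Lemma word_inv_cat u v : word_inv (u ++ v) = word_inv v ++ word_inv u.
Proof. by rewrite /word_inv map_cat rev_cat. Qed.

Lemma word_equiv_ctx a b u v :
  word_equiv u v -> word_equiv (a ++ u ++ b) (a ++ v ++ b).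
Proof.
elim=> [{}u l {}v|{}u|{}u {}v _ /word_equiv_sym //|{}u {}v w _ h1 _ h2].
- have := word_equiv_cancel (a ++ u) l (v ++ b).
  by rewrite -!catA.
- exact: word_equiv_refl.
- exact: word_equiv_trans h1 h2.
Qed.

Lemma word_equiv_cat u u' v v' :
  word_equiv u u' -> word_equiv v v' -> word_equiv (u ++ v) (u' ++ v').
Proof.
move=> uu' vv'.
have h1 := word_equiv_ctx [::] v uu'.
have := word_equiv_ctx u' [::] vv'; rewrite !cats0.
exact: word_equiv_trans h1.
Qed.

Lemma word_equiv_inv u v :
  word_equiv u v -> word_equiv (word_inv u) (word_inv v).
Proof.
elim=> [{}u l {}v|{}u|{}u {}v _ /word_equiv_sym //|{}u {}v w _ h1 _ h2].
- have -> : u ++ l :: letter_inv l :: v = u ++ [:: l; letter_inv l] ++ v by [].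
  rewrite !word_inv_cat -catA [word_inv [:: _; _]]/word_inv /rev /= letter_invK.
  exact: word_equiv_cancel.
- exact: word_equiv_refl.
- exact: word_equiv_trans h1 h2.
Qed.

Lemma word_equiv_mulV u : word_equiv (word_inv u ++ u) [::].
Proof.
elim: u => [|l u IHu]; first exact: word_equiv_refl.
apply: word_equiv_trans IHu.
have -> : word_inv (l :: u) = word_inv u ++ [:: letter_inv l].
  by rewrite -cat1s word_inv_cat.
rewrite -catA -{2}[l]letter_invK /=; exact: word_equiv_cancel.
Qed.

Lemma free_mulA : associative free_mul.
Proof.
move=> x y z; apply/free_piP.
apply: (@word_equiv_trans _ ((repr x ++ repr y) ++ repr z)).
  rewrite -catA; apply: word_equiv_cat (free_reprP _); exact: word_equiv_refl.
apply: word_equiv_cat (word_equiv_refl _).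
exact/word_equiv_sym/free_reprP.
Qed.

Lemma free_mul1 : left_id free_one free_mul.
Proof.
move=> x; rewrite -[RHS]reprK; apply/free_piP.
apply: (@word_equiv_trans _ ([::] ++ repr x)); last exact: word_equiv_refl.
by apply: word_equiv_cat (free_reprP _) (word_equiv_refl _).
Qed.

Lemma free_invK : involutive free_inv.
Proof.
move=> x; rewrite -[RHS]reprK -[in RHS](word_invK (repr x)); apply/free_piP.
exact/word_equiv_inv/free_reprP.
Qed.

Lemma free_invM : {morph free_inv : x y / free_mul x y >-> free_mul y x}.
Proof.
move=> x y; apply/free_piP.
apply: (@word_equiv_trans _ (word_inv (repr y) ++ word_inv (repr x))).
  rewrite -word_inv_cat; exact/word_equiv_inv/free_reprP.
by apply: word_equiv_cat; exact/word_equiv_sym/free_reprP.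
Qed.

Lemma free_mulV : left_inverse free_one free_inv free_mul.
Proof.
move=> x; apply/free_piP; apply: word_equiv_trans (word_equiv_mulV (repr x)).
by apply: word_equiv_cat (free_reprP _) (word_equiv_refl _).
Qed.

HB.instance Definition _ := isStarMonoid.Build free_group
  free_mulA free_mul1 free_invK free_invM.
HB.instance Definition _ := StarMonoid_isGroup.Build free_group free_mulV.

Section Lift.
Variables (G : groupType) (b : X -> G).

Definition letter_eval (l : X * bool) : G := if l.2 then b l.1 else (b l.1)^-1%g.

Definition word_eval (u : word) : G := (\prod_(l <- u) letter_eval l)%g.

Definition free_lift (x : free_group) : G := word_eval (repr x).

Lemma word_eval_equiv u v : word_equiv u v -> word_eval u = word_eval v.
Proof.
elim=> [{}u [x c] {}v|//|//|{}u {}v w _ -> //].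
rewrite /word_eval !big_cat /= !big_cons; congr (_ * _)%g.
by case: c; rewrite /letter_eval /= ?mulKg ?mulVKg.
Qed.

Lemma free_lift_pi u : free_lift (\pi_free_group u) = word_eval u.
Proof. exact/word_eval_equiv/free_reprP. Qed.

Lemma free_lift_gen x : free_lift (free_gen x) = b x.
Proof. by rewrite free_lift_pi /word_eval big_seq1. Qed.

Lemma free_liftM : {morph free_lift : x y / (x * y)%g}.
Proof. by move=> x y; rewrite free_lift_pi /word_eval big_cat. Qed.

End Lift.
End FreeGroup.

Definition is_group_iso_onto (F G : groupType) (f : F -> G) (K : set G) : Prop :=
  {morph f : x y / (x * y)%g} /\ set_bij [set: F] K f.

Section L2.
Variables (R : realType) (G : groupType).

Definition sqnorm (f : G -> R[i]) : \bar R :=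
  \esum_(x in [set: G]) ((normc (f x)) ^+ 2)%:E.

Definition l2_pred : {pred G -> R[i]} := [pred f | `[< (sqnorm f < +oo)%E >]].

Let sqge0 (z : R[i]) : (0 <= ((normc z) ^+ 2)%:E :> \bar R)%E.
Proof. by rewrite lee_fin sqr_ge0. Qed.

Lemma sqnorm_ge0 f : (0 <= sqnorm f)%E.
Proof. exact: esum_ge0. Qed.

Lemma esumZ (c : R) (a : G -> R) : 0 <= c -> (forall x, 0 <= a x) ->
  (\esum_(x in [set: G]) (c * a x)%:E <= c%:E * \esum_(x in [set: G]) (a x)%:E)%E.
Proof.
move=> c0 a0; apply: ge_ereal_sup => _ [A [finA _] <-].
rewrite fsbig_finite//= sumEFin -mulr_sumr EFinM lee_wpmul2l ?lee_fin//.
apply: ereal_sup_ubound; exists A => //.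
by rewrite fsbig_finite//= sumEFin.
Qed.

Lemma normc_sqD (u v : R[i]) :
  (normc (u + v)) ^+ 2 <= 2 * (normc u) ^+ 2 + 2 * (normc v) ^+ 2.
Proof.
case: u v => [a b] [c d] /=.
rewrite !sqr_sqrtr ?addr_ge0 ?sqr_ge0//.
have : 0 <= (a - c) ^+ 2 + (b - d) ^+ 2 by rewrite addr_ge0 ?sqr_ge0.
lra.
Qed.

Lemma sqnormD f g : (sqnorm (f + g)%R <= 2%:E * sqnorm f + 2%:E * sqnorm g)%E.
Proof.
apply: (@le_trans _ _ (\esum_(x in [set: G])
   ((2 * (normc (f x)) ^+ 2)%:E + (2 * (normc (g x)) ^+ 2)%:E)%E)).
  apply: le_esum => x _; rewrite -EFinD lee_fin; exact: normc_sqD.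
rewrite esumD; last 2 first.
- by move=> x _; rewrite lee_fin mulr_ge0 ?sqr_ge0.
- by move=> x _; rewrite lee_fin mulr_ge0 ?sqr_ge0.
by apply: leeD; apply: esumZ => // x; rewrite sqr_ge0.
Qed.

Lemma sqnormZ (a : R[i]) f :
  (sqnorm (a *: f)%R <= ((normc a) ^+ 2)%:E * sqnorm f)%E.
Proof.
apply: le_trans (esumZ (sqr_ge0 (normc a)) (fun x => sqr_ge0 (normc (f x)))).
apply: le_esum => x _; rewrite -exprMn -normcM; exact: lexx.
Qed.

Lemma l2_pred_submod : subsemimod_closed l2_pred.
Proof.
split; first split.
- apply/asboolP; rewrite /sqnorm esum1 ?ltry// => x _.
  by rewrite /= expr0n/= addr0 sqrtr0 expr0n.
- move=> f g /asboolP f2 /asboolP g2; apply/asboolP.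
  apply: le_lt_trans (sqnormD f g) _.
  by rewrite lte_add_pinfty// lte_mul_pinfty// lee_fin.
- move=> a f /asboolP f2; apply/asboolP.
  by apply: le_lt_trans (sqnormZ a f) _; rewrite lte_mul_pinfty// lee_fin sqr_ge0.
Qed.

HB.instance Definition _ :=
  GRing.isSubmodClosed.Build R[i] (G -> R[i]) l2_pred l2_pred_submod.

Record l2 := L2 { l2_fun :> G -> R[i]; _ : l2_fun \in l2_pred }.

HB.instance Definition _ := [isSub for l2_fun].
HB.instance Definition _ := [Choice of l2 by <:].
HB.instance Definition _ := [SubChoice_isSubLmodule of l2 by <:].
End L2.

Section Translations.
Variables (R : realType) (G : groupType).
Local Notation l2 := (l2 R G).

Lemma l2E (f g : l2) : f =1 g -> f = g.
Proof. by move=> fg; apply/val_inj/funext. Qed.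

Lemma sqnorm_bij (f : G -> R[i]) (s t : G -> G) :
  cancel s t -> cancel t s -> sqnorm (f \o s) = sqnorm f.
Proof.
move=> st ts; rewrite /sqnorm [RHS](reindex_esum [set: G] [set: G] s)//.
by split=> // [x y _ _ /(can_inj st)//|y _]; exists (t y).
Qed.

Lemma sqnorm_lmul (f : G -> R[i]) g :
  sqnorm (fun x => f (g^-1 * x)%g) = sqnorm f.
Proof. exact: (sqnorm_bij f (mulVKg g) (mulKg g)). Qed.

Lemma sqnorm_rmul (f : G -> R[i]) g : sqnorm (fun x => f (x * g)%g) = sqnorm f.
Proof. exact: (sqnorm_bij f (mulgK g) (mulgVK g)). Qed.

Fact left_regular_subproof g (f : l2) : (fun x => f (g^-1 * x)%g) \in @l2_pred R G.
Proof. by apply/asboolP; rewrite sqnorm_lmul; case: f => f /= /asboolP. Qed.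

Definition left_regular (g : G) (f : l2) : l2 := L2 (left_regular_subproof g f).

Fact right_regular_subproof g (f : l2) : (fun x => f (x * g)%g) \in @l2_pred R G.
Proof. by apply/asboolP; rewrite sqnorm_rmul; case: f => f /= /asboolP. Qed.

Definition right_regular (g : G) (f : l2) : l2 := L2 (right_regular_subproof g f).

Fact delta_subproof (g : G) : (fun x => (x == g)%:R : R[i]) \in @l2_pred R G.
Proof.
apply/asboolP; rewrite /sqnorm.
under eq_esum => x _.
  have -> : ((normc (x == g)%:R) ^+ 2)%:E = if x \in [set g] then 1%E else 0%E :> \bar R.
    by rewrite in_set1; case: eqP => _; rewrite ?normc1 ?normc0 ?expr1n ?expr0n.
  over.
by rewrite -esum_mkcond esum_set1 ?lee_fin ?ler01 ?ltry.
Qed.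

Definition delta (g : G) : l2 := L2 (delta_subproof g).

Lemma left_regular_linear g : linear (left_regular g).
Proof. by move=> a f h; apply: l2E. Qed.

Lemma right_regular_linear g : linear (right_regular g).
Proof. by move=> a f h; apply: l2E. Qed.

Lemma left_regularM g h f : left_regular (g * h)%g f = left_regular g (left_regular h f).
Proof. by apply: l2E => x /=; rewrite invgM mulgA. Qed.

Lemma left_regular1 f : left_regular 1%g f = f.
Proof. by apply: l2E => x /=; rewrite invg1 mul1g. Qed.

(* The group von Neumann algebra, as the algebra of the G-equivariant bounded
   operators on l^2(G).  It has to contain the left regular representation, so
   equivariance is with respect to the right regular one. *)
Definition is_LG (T : l2 -> l2) : Prop :=
  [/\ linear T,
      exists2 C : R, 0 <= C & forall f, (sqnorm (T f) <= C%:E * sqnorm f)%E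
    & forall g f, T (right_regular g f) = right_regular g (T f)].

Definition LG_pred : {pred l2 -> l2} := [pred T | `[< is_LG T >]].

Lemma is_LG_comp S T : is_LG S -> is_LG T -> is_LG (S \o T).
Proof.
move=> [Sl [C C0 SC] Sr] [Tl [D D0 TD] Tr]; split => [a f h||g f] /=.
- by rewrite Tl Sl.
- exists (C * D) => [|f]; first exact: mulr_ge0.
  apply: (le_trans (SC _)); rewrite EFinM -muleA.
  by apply: lee_wpmul2l => //; rewrite lee_fin.
- by rewrite Tr Sr.
Qed.

Lemma is_LG_id : is_LG idfun.
Proof. by split => //; exists 1 => // f; rewrite mul1e. Qed.

Lemma is_LG_left_regular g : is_LG (left_regular g).
Proof.
split=> [|| h f]; first exact: left_regular_linear.
- by exists 1 => // f; rewrite mul1e sqnorm_lmul.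
- by apply: l2E => x /=; rewrite mulgA.
Qed.

Lemma LG_pred_zmod : zmod_closed LG_pred.
Proof.
split=> [|S T /asboolP[Sl [C C0 SC] Sr] /asboolP[Tl [D D0 TD] Tr]].
  apply/asboolP; split => [a f h||g f].
  - by rewrite scaler0 addr0.
  - exists 0 => // f; rewrite mul0e /sqnorm esum1// => x _.
    by rewrite normc0 expr0n.
  - by apply: l2E.
apply/asboolP; split => [a f h||g f].
- by rewrite !fctE Sl Tl scalerBr opprD addrACA.
- exists (2 * C + 2 * D) => [|f]; first by rewrite addr_ge0 ?mulr_ge0.
  have -> : l2_fun ((S - T) f) = (S f : G -> R[i]) + (- T f : l2).
    by [].
  apply: (le_trans (sqnormD _ _)).
  have -> : sqnorm (- T f : l2) = sqnorm (T f).
    by apply: eq_esum => x _; rewrite normcN.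
  rewrite [(2 * C + 2 * D)%:E]EFinD ge0_muleDl ?lee_fin ?mulr_ge0//.
  rewrite [(2 * C)%:E]EFinM [(2 * D)%:E]EFinM -!muleA.
  by apply: leeD; apply: lee_wpmul2l.
- by rewrite !fctE Sr Tr; apply: l2E.
Qed.

HB.instance Definition _ := GRing.isZmodClosed.Build (l2 -> l2) LG_pred LG_pred_zmod.

Record LG := mkLG { LG_op :> l2 -> l2; _ : LG_op \in LG_pred }.

HB.instance Definition _ := [isSub for LG_op].
HB.instance Definition _ := [Choice of LG by <:].
HB.instance Definition _ := [SubChoice_isSubZmodule of LG by <:].

Lemma LGP (T : LG) : is_LG T.
Proof. by case: T => T /= /asboolP. Qed.

Lemma LGE (S T : LG) : (forall f, S f = T f) -> S = T.
Proof. by move=> ST; apply/val_inj/funext. Qed.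

Definition LG_mul (S T : LG) : LG :=
  mkLG (asboolT (is_LG_comp (LGP S) (LGP T))).
Definition LG_one : LG := mkLG (asboolT is_LG_id).

Fact LG_mulA : associative LG_mul. Proof. by move=> S T U; apply: LGE. Qed.
Fact LG_mul1l : left_id LG_one LG_mul. Proof. by move=> S; apply: LGE. Qed.
Fact LG_mul1r : right_id LG_one LG_mul. Proof. by move=> S; apply: LGE. Qed.
Fact LG_mulDl : left_distributive LG_mul +%R.
Proof. by move=> S T U; apply: LGE. Qed.
Fact LG_mulDr : right_distributive LG_mul +%R.
Proof.
move=> S T U; apply: LGE => f; have [Sl _ _] := LGP S.
by have := Sl 1 (T f) (U f); rewrite !scale1r.
Qed.
Fact LG_one_neq0 : LG_one != 0.
Proof.
apply/eqP => /(congr1 (fun T : LG => T (delta 1%g) 1%g)) /= /eqP.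
by rewrite eqxx oner_eq0.
Qed.

HB.instance Definition _ := GRing.Zmodule_isNzRing.Build LG
  LG_mulA LG_mul1l LG_mul1r LG_mulDl LG_mulDr LG_one_neq0.

Definition lam (g : G) : LG := mkLG (asboolT (is_LG_left_regular g)).

Lemma lamM g h : lam (g * h)%g = lam g * lam h.
Proof. by apply: LGE => f; exact: left_regularM. Qed.

Lemma lam1 : lam 1%g = 1.
Proof. by apply: LGE => f; exact: left_regular1. Qed.

(* This is <T delta_1, delta_1>. *)
Definition LG_trace (T : LG) : R[i] := T (delta 1%g) 1%g.

End Translations.

Section FiniteSupport.
Variable X : choiceType.

Definition fin_supp (M : zmodType) : {pred X -> M} :=
  [pred c | `[< finite_set [set x | c x != 0] >]].

Lemma fin_supp_zmod (M : zmodType) : zmod_closed (@fin_supp M).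
Proof.
split=> [|c d /asboolP cf /asboolP df]; apply/asboolP.
  by apply: (sub_finite_set _ (@finite_set0 X)) => x /=; rewrite eqxx.
have cdf : finite_set ([set x | c x != 0] `|` [set x | d x != 0]).
  by rewrite finite_setU.
apply: sub_finite_set cdf => x /=; rewrite !fctE.
by case: (eqVneq (c x) 0) => [->|]; [rewrite sub0r oppr_eq0; right|left].
Qed.

HB.instance Definition _ (M : zmodType) :=
  GRing.isZmodClosed.Build (X -> M) (@fin_supp M) (@fin_supp_zmod M).

Lemma fin_supp_scale (A : pzRingType) (M : lmodType A) :
  GRing.scaler_closed (@fin_supp M).
Proof.
move=> a c /asboolP cf; apply/asboolP; apply: sub_finite_set cf => x /=.
by apply: contra_neq => /= cx; rewrite fctE cx scaler0.
Qed.

HB.instance Definition _ (A : pzRingType) (M : lmodType A) :=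
  GRing.isScaleClosed.Build A (X -> M) (@fin_supp M) (@fin_supp_scale A M).

Record fchain (M : zmodType) :=
  FChain { fchain_fun :> X -> M; _ : fchain_fun \in @fin_supp M }.

HB.instance Definition _ M := [isSub for @fchain_fun M].
HB.instance Definition _ M := [Choice of fchain M by <:].
HB.instance Definition _ M := [SubChoice_isSubZmodule of fchain M by <:].
HB.instance Definition _ (A : pzRingType) (M : lmodType A) :=
  [SubZmodule_isSubLmodule of fchain M by <:].

Lemma fchainE (M : zmodType) (c d : fchain M) : c =1 d -> c = d.
Proof. by move=> cd; apply/val_inj/funext. Qed.

Lemma fchain_finite (M : zmodType) (c : fchain M) :
  finite_set [set x | c x != 0].
Proof. by case: c => c /= /asboolP. Qed.

Fact fsingle_subproof (M : zmodType) (x : X) (m : M) :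
  (fun y => if y == x then m else 0) \in @fin_supp M.
Proof.
apply/asboolP; apply: (sub_finite_set _ (finite_set1 x)) => y /=.
by case: (y =P x) => // _; rewrite eqxx.
Qed.

Definition fsingle (M : zmodType) (x : X) (m : M) : fchain M :=
  FChain (fsingle_subproof x m).

Lemma fsingle_linear (A : pzRingType) (M : lmodType A) (x : X) :
  linear (@fsingle M x).
Proof.
move=> a m n; apply: fchainE => y /=; rewrite !fctE /=.
by case: eqP => // _; rewrite scaler0 addr0.
Qed.

Lemma fsum_fset (M N : zmodType) (F : X -> M -> N) (c : fchain M)
    (S : {fset X}) : (forall x, F x 0 = 0) ->
  [set x | c x != 0] `<=` [set` S] ->
  \sum_(x \in [set: X]) F x (c x) = \sum_(x <- S) F x (c x).
Proof.
move=> F0 cS; apply: fsbigTE => x xS.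
have [->|cx] := eqVneq (c x) 0; first exact: F0.
by have := cS x cx; rewrite /= (negbTE xS).
Qed.

Lemma fsum_linear (A : pzRingType) (M N : lmodType A) (F : X -> M -> N) :
  (forall x, linear (F x)) ->
  linear (fun c : fchain M => \sum_(x \in [set: X]) F x (c x)).
Proof.
move=> Fl a c d.
have F0 x : F x 0 = 0.
  by have := Fl x (-1) 0 0; rewrite scaler0 addr0 scaleN1r addNr.
pose S := fset_set ([set x | c x != 0] `|` [set x | d x != 0]).
have fS : [set` S] = [set x | c x != 0] `|` [set x | d x != 0].
  by rewrite fset_setK// finite_setU; split; exact: fchain_finite.
rewrite !(@fsum_fset _ _ _ _ S) ?fS//.
- by rewrite scaler_sumr -big_split /=; apply: eq_bigr => x _; rewrite -Fl.
- move=> x /=; rewrite !fctE.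
  have [->|] := eqVneq (c x) 0; last by left.
  by rewrite scaler0 add0r; right.
Qed.

End FiniteSupport.

Definition ZG_act (R : realType) (G : groupType) (x : fchain G int)
    (f : l2 R G) : l2 R G :=
  \sum_(g \in [set: G]) left_regular g f *~ x g.

Section QuotientModule.
Variables (A : pzRingType) (M : lmodType A) (N : submodClosed M).

(* A [submodClosed] predicate is not canonically a [zmodClosed] one. *)
Definition quotmod_pred : {pred M} := [pred m | m \in N].

HB.instance Definition _ := GRing.isZmodClosed.Build M quotmod_pred
  (GRing.subsemimod_closedB (GRing.subsemimodClosedP N)).

Definition quotmod : Type := @Quotient.quot M quotmod_pred.

HB.instance Definition _ := GRing.Zmodule.on quotmod.
HB.instance Definition _ := EqQuotient.on quotmod.

Definition quotmod_scale (a : A) (x : quotmod) : quotmod :=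
  \pi_quotmod (a *: repr x).

Lemma quotmod_piP (m n : M) :
  \pi_quotmod m = \pi_quotmod n <-> m - n \in N.
Proof.
have E := @Quotient.idealrBE M quotmod_pred m n.
by split=> [/eqP|mn]; [rewrite -E|apply/eqP; rewrite -E].
Qed.

Lemma quotmod_scale_pi a m :
  quotmod_scale a (\pi_quotmod m) = \pi_quotmod (a *: m).
Proof.
by apply/quotmod_piP; rewrite -scalerBr rpredZ//; apply/quotmod_piP; rewrite reprK.
Qed.

Lemma quotmod_piD m n :
  \pi_quotmod (m + n) = \pi_quotmod m + \pi_quotmod n.
Proof. exact: Quotient.pi_add. Qed.

Lemma quotmodW (P : quotmod -> Prop) : (forall m, P (\pi_quotmod m)) -> forall x, P x.
Proof. by move=> Ppi x; rewrite -[x]reprK. Qed.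

Fact quotmod_scaleA a b x :
  quotmod_scale a (quotmod_scale b x) = quotmod_scale (a * b) x.
Proof. by elim/quotmodW: x => m; rewrite !quotmod_scale_pi scalerA. Qed.
Fact quotmod_scale1 : left_id 1 quotmod_scale.
Proof. by elim/quotmodW => m; rewrite quotmod_scale_pi scale1r. Qed.
Fact quotmod_scaleDr : right_distributive quotmod_scale +%R.
Proof.
move=> a; elim/quotmodW => m; elim/quotmodW => n.
by rewrite -quotmod_piD !quotmod_scale_pi scalerDr quotmod_piD.
Qed.
Fact quotmod_scaleDl x : {morph quotmod_scale^~ x : a b / a + b}.
Proof.
elim/quotmodW: x => m a b.
by rewrite !quotmod_scale_pi scalerDl quotmod_piD.
Qed.

HB.instance Definition _ := GRing.Zmodule_isLmodule.Build A quotmod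
  quotmod_scaleA quotmod_scale1 quotmod_scaleDr quotmod_scaleDl.

End QuotientModule.

Section H1.
Variables (R : realType) (G : groupType).
Local Notation LG := (LG R G).

(* The bar complex with coefficients in LG, viewed as a right ZG-module through
   the left regular representation; left multiplication makes it a complex of
   left LG-modules.  A chain [c] stands for the sum of the [c g (x) [g]], resp.
   of the [c (g, h) (x) [g|h]]. *)
Definition bar1 := fchain G LG^o.
Definition bar2 := fchain (G * G)%type LG^o.

HB.instance Definition _ := GRing.Lmodule.on bar1.
HB.instance Definition _ := GRing.Lmodule.on bar2.

Definition bar_d1 (c : bar1) : LG^o :=
  \sum_(g \in [set: G]) (c g * lam R g - c g).

Definition bar_d2 (c : bar2) : bar1 :=
  \sum_(p \in [set: G * G])
    (fsingle p.2 (c p * lam R p.1 : LG^o) - fsingle (p.1 * p.2)%g (c p)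
     + fsingle p.1 (c p)).

Lemma bar_d1_linear : linear bar_d1.
Proof.
apply: (@fsum_linear G LG LG^o LG^o (fun g m => m * lam R g - m)) => g a m n.
by rewrite mulrDl opprD scalerBr addrACA scalerAl.
Qed.

Lemma subadd_scale (V : lmodType LG) (a : LG) (x x' y y' z z' : V) :
  (a *: x + x') - (a *: y + y') + (a *: z + z')
    = a *: (x - y + z) + (x' - y' + z').
Proof. 
rewrite !scalerDr scalerN opprD (addrACA (a *: x)).
by rewrite (addrACA (a *: x - a *: y)).
 Qed.

Lemma bar_d2_linear : linear bar_d2.
Proof.
apply: (@fsum_linear _ LG LG^o bar1 (fun p m => fsingle p.2 (m * lam R p.1 : LG^o)
    - fsingle (p.1 * p.2)%g m + fsingle p.1 m)) => p a m n.
have -> : ((a *: m + n) * lam R p.1 : LG^o)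
    = a *: (m * lam R p.1 : LG^o) + n * lam R p.1.
  by rewrite mulrDl scalerAl.
rewrite 3!(fsingle_linear _ a); exact: subadd_scale.
Qed.

HB.instance Definition _ :=
  GRing.isLinear.Build LG bar1 LG^o *:%R bar_d1 bar_d1_linear.
HB.instance Definition _ :=
  GRing.isLinear.Build LG bar2 bar1 *:%R bar_d2 bar_d2_linear.

Lemma bar_d1_single g m : bar_d1 (fsingle g m) = m * lam R g - m.
Proof.
rewrite /bar_d1 (@fsum_fset _ _ _ (fun g m => m * lam R g - m) _ [fset g]%fset).
- by rewrite big_seq_fset1 /= eqxx.
- by move=> h; rewrite mul0r subr0.
- by move=> h /=; case: (h =P g) => [->|_]; rewrite ?eqxx// inE.
Qed.

Lemma bar_d1d2 c : bar_d1 (bar_d2 c) = 0.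
Proof.
rewrite /bar_d2 (@fsum_fset _ _ _ (fun p m => fsingle p.2 (m * lam R p.1 : LG^o)
    - fsingle (p.1 * p.2)%g m + fsingle p.1 m) _ (fset_set [set p | c p != 0])).
- rewrite raddf_sum big1// => p _.
  rewrite raddfD raddfB /= !bar_d1_single lamM mulrA.
  by rewrite opprB [X in X + _]addrC subrKA addrA addrNK subrr.
- move=> p; rewrite mul0r; have fs0 g : fsingle g 0 = 0 :> bar1.
    by apply: fchainE => h /=; case: ifP.
  by rewrite !fs0 subrr addr0.
- by rewrite fset_setK//; exact: fchain_finite.
Qed.

Definition cycle1_pred : {pred bar1} := [pred c | bar_d1 c == 0].

Lemma cycle1_submod : subsemimod_closed cycle1_pred.
Proof.
split; first split.
- by rewrite inE raddf0.
- by move=> c d /eqP c0 /eqP d0; rewrite inE raddfD /= c0 d0 addr0.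
- by move=> a c /eqP c0; apply/eqP; rewrite linearZ /= c0 scaler0.
Qed.

HB.instance Definition _ :=
  GRing.isSubmodClosed.Build LG bar1 cycle1_pred cycle1_submod.

Record cycle1 := Cycle1 { cycle1_val :> bar1; _ : cycle1_val \in cycle1_pred }.

HB.instance Definition _ := [isSub for cycle1_val].
HB.instance Definition _ := [Choice of cycle1 by <:].
HB.instance Definition _ := [SubChoice_isSubLmodule of cycle1 by <:].

Definition boundary1_pred : {pred cycle1} :=
  [pred z | `[< exists c : bar2, bar_d2 c = cycle1_val z >]].

Lemma boundary1_submod : subsemimod_closed boundary1_pred.
Proof.
split; first split.
- by apply/asboolP; exists 0; rewrite raddf0.
- move=> z w /asboolP[c cz] /asboolP[d dw]; apply/asboolP.
  by exists (c + d); rewrite raddfD /= cz dw.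
- move=> a z /asboolP[c cz]; apply/asboolP.
  by exists (a *: c); rewrite linearZ /= cz.
Qed.

HB.instance Definition _ :=
  GRing.isSubmodClosed.Build LG cycle1 boundary1_pred boundary1_submod.

Definition H1 : lmodType LG := quotmod boundary1_pred.

End H1.

Section Dimension.
Variables (R : realType) (G : groupType).
Local Notation LG := (LG R G).

(* [P] is a finitely generated projective submodule of [M] of von Neumann
   dimension [r], i.e. isomorphic to the image of an idempotent matrix of trace
   [r].  That [phi] is defined on all row vectors is no restriction: a linear
   map on the image of [A] extends by precomposition with [A]. *)
Definition fg_projective_dim (M : lmodType LG) (P : set M) (r : R) : Prop :=
  exists (n : nat) (A : 'M[LG]_n) (phi : {linear 'rV[LG]_n -> M}),
    [/\ A *m A = A,
        set_bij (range (fun v : 'rV[LG]_n => v *m A)) P phi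
      & \sum_i LG_trace (A i i) = r%:C%C].

(* Lück's dimension of an arbitrary, purely algebraic, LG-module. *)
Definition dim_LG (M : lmodType LG) : \bar R :=
  ereal_sup [set r%:E | r in [set r | exists P : set M, fg_projective_dim P r]].

Definition l2betti1 : \bar R := dim_LG (H1 R G).

End Dimension.

Definition eceil (R : realType) (x : \bar R) : \bar R :=
  er_map (fun r => (Num.ceil r)%:~R) x.

(* Main.v *)
(* If no k+1 of the generators a_1, ..., a_n are free, every k+1 of them satisfy
   a relation, and for a relation of minimal length some Fox derivative is a
   nonzero element of ZG, hence a nonzerodivisor in LG.  Modulo boundaries the
   1-chains are generated by the classes [a_j], and the Fox derivatives of a
   relation are the coefficients of a linear relation between these classes;
   eliminating generators one at a time therefore gives an (n - k) x n matrix F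
   of relations which is triangular with nonzerodivisors on the diagonal.  A
   projective submodule of H_1 of dimension r, written in the classes [a_j] by a
   matrix B, then has the property that (x, y) |-> x B + y F is injective on it
   times LG^(n - k).  All rows of B and F annihilate the column (a_j - 1)_j, one
   entry of which is a nonzerodivisor, so the rank of this map is at most n - 1
   and r <= k - 1.

   Ranks are estimated by traces: for a contraction W over LG, the powers of
   1 - W W^* converge to the projection onto the kernel of W^*, and
   tr (W W^* ) = tr (W^* W) compares the two sides. *)

Require Import Defs.
From mathcomp Require Import all_boot all_order all_algebra.
From mathcomp Require Import finmap complex ring lra zify.
From mathcomp Require Import boolp classical_sets functions cardinality fsbigop.
From mathcomp Require Import reals ereal esum topology normedtype sequences.

Set Implicit Arguments.
Unset Strict Implicit.
Unset Printing Implicit Defensive.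

Import Order.TTheory GRing.Theory Num.Theory.
Import ComplexField.Normc numFieldNormedType.Exports.

Local Open Scope classical_set_scope.
Local Open Scope ring_scope.

(** * The real inner product of l2 *)

Section InnerProduct.
Variables (R : realType) (G : groupType).
Local Notation l2 := (l2 R G).
Implicit Types (f g h : l2) (z w : R[i]).

(** The squared modulus without the square root in [normc]: identities between values become
    polynomial and accessible to [ring]. *)
Definition nsq z : R := complex.Re z ^+ 2 + complex.Im z ^+ 2.

Lemma normc_nsq z : normc z ^+ 2 = nsq z.
Proof. by case: z => a b; rewrite /nsq /= sqr_sqrtr// addr_ge0 ?sqr_ge0. Qed.

Lemma nsq_ge0 z : 0 <= nsq z.
Proof. by rewrite /nsq addr_ge0 ?sqr_ge0. Qed.

Lemma sqnormE (f : G -> R[i]) :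
  sqnorm f = (\esum_(x in [set: G]) (nsq (f x))%:E)%E.
Proof. by apply: eq_esum => x _; rewrite normc_nsq. Qed.

Definition sqn f : R := fine (sqnorm f).

Lemma sqnE f : ((sqn f)%:E = sqnorm f)%E.
Proof.
rewrite /sqn fineK// ge0_fin_numE ?sqnorm_ge0//.
by case: f => f /= /asboolP.
Qed.

Lemma sqn_ge0 f : 0 <= sqn f.
Proof. by rewrite -lee_fin sqnE sqnorm_ge0. Qed.

Lemma esumZE (c : R) (a : G -> R) : 0 <= c -> (forall x, 0 <= a x) ->
  (\esum_(x in [set: G]) (c * a x)%:E = c%:E * \esum_(x in [set: G]) (a x)%:E)%E.
Proof.
move=> c0 a0; apply/eqP; rewrite eq_le esumZ//=.
have [->|cn] := eqVneq c 0.
  by rewrite mul0e esum_ge0// => x _; rewrite mul0r.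
have cp : 0 < c by rewrite lt_def cn.
rewrite -lee_pdivlMl//.
apply: le_trans (esumZ (c := c^-1) _ _); rewrite ?invr_ge0//.
- by apply: le_esum => x _; rewrite mulKf.
- by move=> x; rewrite mulr_ge0.
Qed.

Lemma sqn_sumE (s : seq (R * l2)) : all (fun p => 0 <= p.1) s ->
  ((\sum_(p <- s) p.1 * sqn p.2)%:E =
    \esum_(x in [set: G]) (\sum_(p <- s) p.1 * nsq (p.2 x))%:E)%E.
Proof.
have pos (t : seq (R * l2)) : all (fun p => 0 <= p.1) t ->
    forall x, 0 <= \sum_(p <- t) p.1 * nsq (p.2 x).
  move=> t0 x; rewrite big_seq_cond sumr_ge0// => p; rewrite andbT => pt.
  by rewrite mulr_ge0 ?nsq_ge0//; exact: (allP t0).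
elim: s => [_|[c f] s IHs /= /andP[c0 s0]].
  by rewrite big_nil esum1// => x _; rewrite big_nil.
rewrite big_cons EFinD IHs//= EFinM sqnE sqnormE -esumZE//; last first.
  by move=> x; exact: nsq_ge0.
rewrite -esumD.
- by apply: eq_esum => x _; rewrite big_cons.
- by move=> x _; rewrite lee_fin mulr_ge0 ?nsq_ge0.
- by move=> x _; rewrite lee_fin pos.
Qed.

(* Identities between squared norms follow from the same identities between the values,
   once all coefficients have been made nonnegative. *)
Lemma sqn_id (s t : seq (R * l2)) :
  all (fun p => 0 <= p.1) s -> all (fun p => 0 <= p.1) t ->
  (forall x, \sum_(p <- s) p.1 * nsq (p.2 x) = \sum_(p <- t) p.1 * nsq (p.2 x)) ->
  \sum_(p <- s) p.1 * sqn p.2 = \sum_(p <- t) p.1 * sqn p.2.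
Proof.
move=> s0 t0 st; apply: EFin_inj; rewrite !sqn_sumE//.
by apply: eq_esum => x _; rewrite st.
Qed.

(** Real homogeneity of the inner product before polarization, with the terms arranged so that all
    coefficients are nonnegative when [0 <= r]. *)
Lemma sqn_line (r : R) f g : 0 <= r ->
  sqn (f + r%:C%C *: g) + r * sqn f + r * sqn g =
  sqn f + r ^+ 2 * sqn g + r * sqn (f + g).
Proof.
move=> r0.
have := @sqn_id [:: (1, f + r%:C%C *: g); (r, f); (r, g)]
  [:: (1, f); (r ^+ 2, g); (r, f + g)].
rewrite /= !(big_cons, big_nil)/= !mul1r !addr0 !addrA; apply.
- by rewrite ler01 r0.
- by rewrite ler01 r0 sqr_ge0.
move=> x; rewrite !(big_cons, big_nil)/= !fctE /=.
by case: (f x) (g x) => [a b] [c d]; rewrite /nsq /=; ring.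
Qed.

Lemma sqnZ z f : sqn (z *: f) = nsq z * sqn f.
Proof.
have := @sqn_id [:: (1, z *: f)] [:: (nsq z, f)].
rewrite /= !big_seq1/= !mul1r; apply; rewrite ?ler01 ?nsq_ge0//.
move=> x; rewrite !big_seq1/= !fctE /=.
by case: (f x) z => [a b] [c d]; rewrite /nsq /=; ring.
Qed.

(** The third difference of a quadratic form vanishes; after polarization this is additivity of
    [ip]. *)
Lemma sqn_cube f g h :
  sqn (f + g + h) + sqn f + sqn g + sqn h = sqn (f + g) + sqn (f + h) + sqn (g + h).
Proof.
have := @sqn_id [:: (1, f + g + h); (1, f); (1, g); (1, h)]
  [:: (1, f + g); (1, f + h); (1, g + h)].
rewrite /= !(big_cons, big_nil)/= !mul1r !addr0 !addrA; apply.
- by rewrite ler01.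
- by rewrite ler01.
move=> x; rewrite !(big_cons, big_nil)/= !fctE /=.
by case: (f x) (g x) (h x) => [a b] [c d] [i j]; rewrite /nsq /=; ring.
Qed.

(* The real part of the Hermitian product; the imaginary part is
   [ip f ('i%C *: g)]. *)
Definition ip f g : R := (sqn (f + g) - sqn f - sqn g) / 2.

Lemma sqnD f g : sqn (f + g) = sqn f + sqn g + 2 * ip f g.
Proof. by rewrite /ip; field. Qed.

Lemma sqn0 : sqn 0 = 0.
Proof. by rewrite -(scale0r 0) sqnZ /nsq /=; ring. Qed.

Lemma sqnN f : sqn (- f) = sqn f.
Proof. by rewrite -scaleN1r sqnZ /nsq /=; ring. Qed.

Lemma ipC f g : ip f g = ip g f.
Proof. by rewrite /ip (addrC f) addrAC. Qed.

Lemma ipDl f g h : ip (f + g) h = ip f h + ip g h.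
Proof. by have := sqn_cube f g h; rewrite /ip => ?; lra. Qed.

Lemma ipDr f g h : ip f (g + h) = ip f g + ip f h.
Proof. by rewrite ipC ipDl !(ipC f). Qed.

Lemma ip0l f : ip 0 f = 0.
Proof. by rewrite /ip add0r sqn0; lra. Qed.

Lemma ip0r f : ip f 0 = 0.
Proof. by rewrite ipC ip0l. Qed.

Lemma ipNl f g : ip (- f) g = - ip f g.
Proof. by apply/eqP; rewrite -addr_eq0 -ipDl addNr ip0l. Qed.

Lemma ipNr f g : ip f (- g) = - ip f g.
Proof. by rewrite ipC ipNl ipC. Qed.

Lemma ipBl f g h : ip (f - g) h = ip f h - ip g h.
Proof. by rewrite ipDl ipNl. Qed.

Lemma ipff f : ip f f = sqn f.
Proof.
have -> : ip f f = (sqn (f + f) - sqn f - sqn f) / 2 by [].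
by rewrite -mulr2n -scaler_nat sqnZ /nsq /=; lra.
Qed.

Lemma sqnB f g : sqn (f - g) = sqn f + sqn g - 2 * ip f g.
Proof. by rewrite sqnD sqnN ipNr; ring. Qed.

Lemma ipZr (r : R) f g : ip f (r%:C%C *: g) = r * ip f g.
Proof.
wlog r0 : r / 0 <= r => [hw|].
  case: (leP 0 r) => [/hw//|r0].
  have -> : r%:C%C *: g = - ((- r)%:C%C *: g).
    by rewrite -scaleNr; congr (_ *: _); rewrite /= -raddfN opprK.
  by rewrite ipNr hw ?oppr_ge0 1?ltW// mulNr opprK.
have := sqn_line f g r0; rewrite !sqnD sqnZ.
have -> : nsq r%:C%C = r ^+ 2 by rewrite /nsq /=; ring.
by move=> ?; lra.
Qed.

Lemma ipZl (r : R) f g : ip (r%:C%C *: f) g = r * ip f g.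
Proof. by rewrite ipC ipZr ipC. Qed.

Lemma ip_sumr (I : Type) (s : seq I) (P : pred I) (F : I -> l2) f :
  ip f (\sum_(i <- s | P i) F i) = \sum_(i <- s | P i) ip f (F i).
Proof. by apply: (big_morph (ip f) (fun g h => ipDr f g h) (ip0r f)). Qed.

Lemma ip_iso (u : l2 -> l2) f g : {morph u : x y / x + y} ->
  (forall h, sqn (u h) = sqn h) -> ip (u f) (u g) = ip f g.
Proof. by move=> uD un; rewrite /ip -uD !un. Qed.

Lemma ip_ii f g : ip ('i%C *: f) ('i%C *: g) = ip f g.
Proof.
apply: (@ip_iso (fun h => 'i%C *: h)) => [? ?|h]; first exact: scalerDr.
by rewrite sqnZ /nsq /=; ring.
Qed.

Lemma scale_ii f : 'i%C *: ('i%C *: f) = - f.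
Proof. by rewrite scalerA -expr2 sqr_i scaleN1r. Qed.

Lemma ip_ir f g : ip f ('i%C *: g) = - ip ('i%C *: f) g.
Proof. by rewrite -[LHS]ip_ii scale_ii ipNr. Qed.

Lemma ip_il f g : ip ('i%C *: f) g = - ip f ('i%C *: g).
Proof. by rewrite ip_ir opprK. Qed.

Lemma l2_sumE (I : Type) (s : seq I) (P : pred I) (F : I -> l2) x :
  (\sum_(i <- s | P i) F i) x = \sum_(i <- s | P i) F i x.
Proof. by apply: (big_morph (fun f : l2 => f x)). Qed.

Lemma l2_scaleE z f x : (z *: f) x = z * f x.
Proof. by []. Qed.

Lemma sqn_ge_sum f (A : {fset G}) : \sum_(x <- A) nsq (f x) <= sqn f.
Proof.
rewrite -lee_fin sqnE sqnormE; apply: esum_ge; exists [set` A].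
  by split => //; exact: finite_fset.
by rewrite fsbig_finite//= set_fsetK sumEFin.
Qed.

Lemma sqn_ge_val f x : nsq (f x) <= sqn f.
Proof. by have := sqn_ge_sum f [fset x]%fset; rewrite big_seq_fset1. Qed.

Lemma nsq_eq0 z : nsq z = 0 -> z = 0.
Proof.
case: z => a b; rewrite /nsq /= => /eqP.
by rewrite paddr_eq0 ?sqr_ge0// !sqrf_eq0 => /andP[/eqP-> /eqP->].
Qed.

Lemma sqn_eq0 f : sqn f = 0 -> f = 0.
Proof.
move=> f0; apply: l2E => x; apply: nsq_eq0; apply/eqP.
by rewrite eq_le nsq_ge0 andbT -f0 sqn_ge_val.
Qed.

Lemma cauchy_schwarz f g : ip f g ^+ 2 <= sqn f * sqn g.
Proof.
have [g0|gn0] := eqVneq (sqn g) 0.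
  by rewrite (sqn_eq0 g0) ip0r sqn0 mulr0 expr0n.
have gp : 0 < sqn g by rewrite lt_def gn0 sqn_ge0.
have := sqn_ge0 ((sqn g)%:C%C *: f - (ip f g)%:C%C *: g).
have nsqR r : nsq r%:C%C = r ^+ 2 by rewrite /nsq /=; ring.
rewrite sqnB !sqnZ ipZl ipZr !nsqR => h.
rewrite -subr_ge0 -(pmulr_rge0 _ gp); move: h.
by congr (0 <= _); ring.
Qed.

Lemma sqn_delta z x : sqn (z *: delta R x) = nsq z.
Proof.
apply: EFin_inj; rewrite sqnE sqnormE.
under eq_esum => y _.
  have -> : (nsq ((z *: delta R x) y))%:E =
      if y \in [set x] then (nsq z)%:E else 0%E :> \bar R.
    rewrite in_set1 /= fctE /=; case: eqP => _; first by rewrite scaler1.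
    by rewrite scaler0 /nsq /=; congr (_%:E); ring.
  over.
by rewrite -esum_mkcond esum_set1// lee_fin nsq_ge0.
Qed.

Lemma ip_delta f x : ip f (delta R x) = complex.Re (f x).
Proof.
have := sqn_delta^~ x; have : forall y, delta R x y = (y == x)%:R by [].
move: (delta R x) => d dE nd.
(* Outside [x] the multiples of [d] vanish, and at [x] the two terms on each side change places.
   Comparison with [sqnD] then isolates the real part of [f x]. *)
have e : 1 * sqn (f + d) + (1 * sqn (f x *: d) + 0)
    = 1 * sqn f + (1 * sqn ((f x + 1) *: d) + 0).
  have := @sqn_id [:: (1, f + d); (1, f x *: d)] [:: (1, f); (1, (f x + 1) *: d)].
  rewrite !(big_cons, big_nil); apply; rewrite /= ?ler01// => y.
  rewrite !(big_cons, big_nil) /= !fctE /= dE.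
  case: (y =P x) => [->|_].
    by case: (f x) => a b; rewrite /nsq /=; ring.
  by case: (f x) (f y) => [a b] [c i]; rewrite /nsq /=; ring.
move: e; rewrite (nd (f x)) (nd (f x + 1)) sqnD -[in X in _ + X + _](scale1r d) (nd 1).
by case: (f x) => a b; rewrite /nsq /= => e; lra.
Qed.

End InnerProduct.

(** * Density of finite combinations of delta functions in l2 *)

Section Density.
Variables (R : realType) (G : groupType).
Local Notation l2 := (l2 R G).
Implicit Types (f g h : l2) (z w : R[i]) (A : {fset G}).

Lemma ip_deltaZ f z x : ip f (z *: delta R x) =
  complex.Re z * complex.Re (f x) + complex.Im z * complex.Im (f x).
Proof.
have -> : z *: delta R x =
    (complex.Re z)%:C%C *: delta R x + (complex.Im z)%:C%C *: ('i%C *: delta R x).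
  by rewrite scalerA -scalerDl [in LHS](complexE z) (mulrC 'i%C).
rewrite ipDr !ipZr ip_ir !ip_delta l2_scaleE.
by case: (f x) z => [a b] [c d] /=; ring.
Qed.

Definition fin_comb (c : G -> R[i]) A : l2 := \sum_(x <- A) c x *: delta R x.

Lemma fin_combE c A y : fin_comb c A y = if y \in A then c y else 0.
Proof.
rewrite /fin_comb l2_sumE.
have -> : \sum_(x <- A) (c x *: delta R x) y = \sum_(x <- A) c x * (y == x)%:R.
  by apply: eq_bigr => x _; rewrite l2_scaleE.
case: ifPn => yA.
  rewrite (big_fsetD1 y)//= big_seq big1 ?addr0 => [|x]; first by rewrite eqxx mulr1.
  by rewrite !inE eq_sym => /andP[/negPf-> _]; rewrite mulr0.
rewrite big_seq big1// => x xA.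
by case: (y =P x) => [yx|_]; rewrite ?mulr0//; rewrite yx xA in yA.
Qed.

Lemma sqn_fin_comb c A : sqn (fin_comb c A) = \sum_(x <- A) nsq (c x).
Proof.
rewrite -ipff {2}/fin_comb ip_sumr big_seq [RHS]big_seq.
apply: eq_bigr => x xA.
by rewrite ip_deltaZ fin_combE xA /nsq -!expr2.
Qed.

(** The squared norm is a supremum of finite sums, and the error of a truncation of [f] is exactly
    the part missing from the sum. *)
Lemma fin_comb_dense f (e : R) : 0 < e -> exists A, sqn (f - fin_comb f A) < e.
Proof.
move=> e0.
have : ((sqn f - e)%:E < sqnorm f)%E by rewrite -sqnE lte_fin ltrBlDr ltrDl.
rewrite sqnormE => /ereal_sup_gt[_ [S [finS _] <-]].
rewrite fsbig_finite//= sumEFin lte_fin => le.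
exists (fset_set S); set A := fset_set S.
rewrite sqnB sqn_fin_comb {1}/fin_comb ip_sumr mulr_sumr.
have -> : \sum_(x <- A) 2 * ip f (f x *: delta R x) = 2 * \sum_(x <- A) nsq (f x).
  by rewrite mulr_sumr; apply: eq_bigr => x _; rewrite ip_deltaZ /nsq -!expr2.
by move: le; rewrite -/A => ?; lra.
Qed.

(** [phi] takes the same value on [f] and on the difference of [f] and a truncation, whose norm is
    arbitrarily small. *)
Lemma dense_eq0 (phi : l2 -> R) (K : R) :
  {morph phi : f g / f + g} -> (forall f, phi f ^+ 2 <= K * sqn f) ->
  (forall z x, phi (z *: delta R x) = 0) -> forall f, phi f = 0.
Proof.
move=> phiD phiK phi0 f.
have p0 : phi 0 = 0 by rewrite -(phi0 0 1%g) scale0r.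
have [le0|K0] := leP (phi f ^+ 2) 0.
  by apply/eqP; rewrite -sqrf_eq0 eq_le le0 sqr_ge0.
(* With this error [K] times the squared distance stays below [phi f ^+ 2]; the added 1 avoids a
   division by zero. *)
have e0 : 0 < phi f ^+ 2 / (`|K| + 1) by rewrite divr_gt0// ltr_wpDl.
have [A] := fin_comb_dense f e0.
rewrite ltr_pdivlMr ?ltr_wpDl// => lt.
have := phiK (f - fin_comb f A); rewrite phiD.
have -> : phi (- fin_comb f A) = 0.
  rewrite /fin_comb -sumrN (big_morph phi phiD p0) big1// => x _.
  by rewrite -scaleNr phi0.
rewrite addr0 => le; suff : phi f ^+ 2 < phi f ^+ 2 by rewrite ltxx.
apply: le_lt_trans le (le_lt_trans _ lt); rewrite mulrC ler_wpM2l ?sqn_ge0//.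
by rewrite (le_trans (ler_norm _))// lerDl.
Qed.

End Density.

(** * Adjoints and the trace on LG *)

Section Adjoint.
Variables (R : realType) (G : groupType).
Local Notation l2 := (l2 R G).
Local Notation LG := (LG R G).
Implicit Types (f g h : l2) (z w : R[i]) (A : {fset G}) (T S : LG).

Lemma LG_bound T : exists2 C : R, 0 <= C & forall f, sqn (T f) <= C * sqn f.
Proof.
have [_ [C C0 TC] _] := LGP T; exists C => // f.
by rewrite -lee_fin EFinM !sqnE.
Qed.

Lemma LG_linear T : linear T.
Proof. by have [] := LGP T. Qed.

Lemma LGD T f g : T (f + g) = T f + T g.
Proof. by have := LG_linear T 1 f g; rewrite !scale1r. Qed.

Lemma LG0 T : T 0 = 0.
Proof. by apply: (addrI (T 0)); rewrite -LGD !addr0. Qed.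

Lemma LGZ T z f : T (z *: f) = z *: T f.
Proof. by have := LG_linear T z f 0; rewrite LG0 !addr0. Qed.

Lemma LG_rr T (g : G) f : T (right_regular g f) = right_regular g (T f).
Proof. by have [] := LGP T. Qed.

Lemma LG_sum T (I : Type) (s : seq I) (P : pred I) (F : I -> l2) :
  T (\sum_(i <- s | P i) F i) = \sum_(i <- s | P i) T (F i).
Proof. exact: (big_morph T (LGD T) (LG0 T)). Qed.

Lemma sqn_rr (g : G) f : sqn (right_regular g f) = sqn f.
Proof. by apply: EFin_inj; rewrite !sqnE sqnorm_rmul. Qed.

Lemma sqn_lr (g : G) f : sqn (left_regular g f) = sqn f.
Proof. by apply: EFin_inj; rewrite !sqnE sqnorm_lmul. Qed.

Lemma rrD (g : G) : {morph @right_regular R G g : f h / f + h}.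
Proof. by move=> f h; apply: l2E. Qed.

Lemma rr_delta (g : G) (x : G) : right_regular g (delta R x) = delta R (x * g^-1)%g.
Proof. by apply: l2E => y /=; rewrite -(inj_eq (mulIg g) y) mulgVK. Qed.

Lemma ip_rr (g : G) f h : ip (right_regular g f) h = ip f (right_regular g^-1%g h).
Proof.
have -> : h = right_regular g (right_regular g^-1%g h).
  by apply: l2E => x /=; rewrite mulgK.
rewrite (ip_iso _ _ (rrD g) (sqn_rr g)); congr ip.
by apply: l2E => x /=; rewrite mulgK.
Qed.

(* The Hermitian product of [f] with [T (delta x)]. *)
Definition adj_fun T f (x : G) : R[i] :=
  (ip f (T (delta R x)) +i* ip f (T ('i%C *: delta R x)))%C.

Lemma ip_LG_deltaZ T f z x : ip f (T (z *: delta R x)) =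
  complex.Re z * complex.Re (adj_fun T f x) +
  complex.Im z * complex.Im (adj_fun T f x).
Proof.
have -> : z *: delta R x =
    (complex.Re z)%:C%C *: delta R x + (complex.Im z)%:C%C *: ('i%C *: delta R x).
  by rewrite scalerA -scalerDl [in LHS](complexE z) (mulrC 'i%C).
by rewrite LGD 2!(LGZ _ _%:C%C) ipDr !ipZr.
Qed.

(** Pairing [f] with the image of the truncated candidate itself yields the partial sum [s];
    Cauchy-Schwarz then reads [s^2 <= C |f|^2 s], and one factor [s] cancels. *)
Lemma adj_fun_sum T C f A : 0 <= C -> (forall f, sqn (T f) <= C * sqn f) ->
  \sum_(x <- A) nsq (adj_fun T f x) <= C * sqn f.
Proof.
move=> C0 TC; set s := \sum_(x <- A) _.
have s0 : 0 <= s by apply: sumr_ge0 => x _; exact: nsq_ge0.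
have e : ip f (T (fin_comb (adj_fun T f) A)) = s.
  rewrite LG_sum ip_sumr; apply: eq_bigr => x _.
  by rewrite ip_LG_deltaZ /nsq -!expr2.
have := cauchy_schwarz f (T (fin_comb (adj_fun T f) A)); rewrite e => cs.
have := le_trans cs (ler_wpM2l (sqn_ge0 f) (TC _)).
rewrite sqn_fin_comb -/s => le.
have [->|sn0] := eqVneq s 0; first by rewrite mulr_ge0 ?sqn_ge0.
have sp : 0 < s by rewrite lt_def sn0.
by rewrite -(ler_pM2r sp) -expr2 (le_trans le)// mulrCA mulrA.
Qed.

Fact adj_fun_l2 T f : adj_fun T f \in @l2_pred R G.
Proof.
have [C C0 TC] := LG_bound T.
apply/asboolP; apply: (@le_lt_trans _ _ (C * sqn f)%:E); last exact: ltry.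
rewrite sqnormE; apply: ge_ereal_sup => _ [S [finS _] <-].
by rewrite fsbig_finite//= sumEFin lee_fin adj_fun_sum.
Qed.

Definition adj_op T f : l2 := L2 (adj_fun_l2 T f).

(** Both sides are bounded additive functions of [h] that agree on multiples of delta functions, so
    density decides. The bound combines [(u - v)^2 <= 2 u^2 + 2 v^2] with Cauchy-Schwarz. *)
Lemma adj_opP T f h : ip (adj_op T f) h = ip f (T h).
Proof.
apply/eqP; rewrite -subr_eq0; apply/eqP; have [C C0 TC] := LG_bound T.
apply: (@dense_eq0 _ _ (fun h => ip (adj_op T f) h - ip f (T h))
  (2 * sqn (adj_op T f) + 2 * (C * sqn f))) => [u v|u|z x].
- by rewrite LGD !ipDr; ring.
- have cs1 := cauchy_schwarz (adj_op T f) u.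
  have cs2 := cauchy_schwarz f (T u).
  have := le_trans cs2 (ler_wpM2l (sqn_ge0 f) (TC u)) => {}cs2.
  move: cs1 cs2; set a := ip _ _; set b := ip _ _ => cs1 cs2.
  have := sqr_ge0 (a + b); rewrite sqrrD sqrrB => h1.
  by lra.
- by rewrite ip_deltaZ ip_LG_deltaZ subrr.
Qed.

Lemma ip_ext f g : (forall h, ip f h = ip g h) -> f = g.
Proof.
move=> fg; apply/eqP; rewrite -subr_eq0; apply/eqP/sqn_eq0.
by rewrite -ipff ipBl fg subrr.
Qed.

Lemma adj_op_LG T : is_LG (adj_op T).
Proof.
split=> [z f g|| g f].
- apply: ip_ext => h; rewrite [RHS]ipDl !adj_opP ipDl; congr (_ + _).
  rewrite [in LHS](complexE z) [in RHS](complexE z) !(scalerDl, ipDl) !ipZl.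
  rewrite (mulrC 'i%C) -!scalerA !ipZl !adj_opP.
  by rewrite !ip_il !adj_opP LGZ.
- have [C C0 TC] := LG_bound T; exists C => // f.
  rewrite -!sqnE -EFinM sqnE sqnormE; apply: ge_ereal_sup => _ [S [finS _] <-].
  by rewrite fsbig_finite//= sumEFin lee_fin adj_fun_sum.
- apply: ip_ext => h; rewrite ip_rr !adj_opP LG_rr ip_rr.
  by [].
Qed.

Definition star T : LG := mkLG (asboolT (adj_op_LG T)).

Lemma starP T f h : ip (star T f) h = ip f (T h).
Proof. exact: adj_opP. Qed.

Lemma starK : involutive star.
Proof. by move=> T; apply: LGE => f; apply: ip_ext => h; rewrite starP ipC starP ipC. Qed.

Lemma starM S T : star (S * T) = star T * star S.
Proof.
apply: LGE => f; apply: ip_ext => h.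
by rewrite starP [RHS](starP T) starP.
Qed.

Lemma starD S T : star (S + T) = star S + star T.
Proof.
apply: LGE => f; apply: ip_ext => h.
by rewrite starP [RHS]ipDl !starP -ipDr.
Qed.

Lemma star1 : star 1 = 1.
Proof. by apply: LGE => f; apply: ip_ext => h; rewrite starP. Qed.

Lemma star0 : star 0 = 0.
Proof. by apply: (addrI (star 0)); rewrite -starD !addr0. Qed.

Lemma starN T : star (- T) = - star T.
Proof. by apply: (addrI (star T)); rewrite -starD !subrr star0. Qed.

Lemma star_lam (g : G) : star (lam R g) = lam R g^-1%g.
Proof.
apply: LGE => f; apply: ip_ext => h; rewrite starP /=.
rewrite -[RHS](@ip_iso _ _ (left_regular g)); last exact: sqn_lr.
- by rewrite -left_regularM mulgV left_regular1.
- by move=> u v; apply: l2E.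
Qed.

(** Only the real part is kept, since the traces that define the dimension are real. *)
Definition retr T : R := complex.Re (LG_trace T).

Lemma retrE T : retr T = ip (T (delta R 1%g)) (delta R 1%g).
Proof. by rewrite ip_delta. Qed.

Lemma retrD S T : retr (S + T) = retr S + retr T.
Proof. by rewrite !retrE -ipDl. Qed.

Lemma retr0 : retr 0 = 0.
Proof. by apply: (addrI (retr 0)); rewrite -retrD !addr0. Qed.

Lemma retrN T : retr (- T) = - retr T.
Proof. by apply: (addrI (retr T)); rewrite -retrD !subrr retr0. Qed.

Lemma retr_star T : retr (star T) = retr T.
Proof. by rewrite !retrE starP ipC. Qed.

Lemma retr1 : retr 1 = 1.
Proof. by rewrite /retr /LG_trace /= eqxx. Qed.

Lemma retr_starM T : retr (star T * T) = sqn (T (delta R 1%g)).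
Proof. by rewrite retrE [LHS](starP T) ipff. Qed.

(** By right equivariance, the coefficient at [x] on the left is the complex conjugate of the one at
    the inverse of [x] on the right. *)
Lemma star_delta1 T x : nsq (star T (delta R 1%g) x) = nsq (T (delta R 1%g) x^-1%g).
Proof.
have e : delta R x = right_regular x^-1%g (delta R 1%g).
  by rewrite rr_delta invgK mul1g.
have re f : ip (delta R 1%g) f = complex.Re (f 1%g) by rewrite ipC ip_delta.
rewrite /= /adj_fun LGZ !re l2_scaleE e LG_rr /= mul1g.
by case: (T _ _) => a b; rewrite /nsq /=; ring.
Qed.

Lemma sqn_star_delta1 T : sqn (star T (delta R 1%g)) = sqn (T (delta R 1%g)).
Proof.
apply: EFin_inj; rewrite !sqnE !sqnormE.
under eq_esum do rewrite star_delta1.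
rewrite [RHS](reindex_esum [set: G] [set: G] (fun x : G => x^-1)%g)//.
by split=> // [x y _ _ /invg_inj//|y _]; exists y^-1%g => //; rewrite invgK.
Qed.

(* By polarization it is enough that [T T^* ] and [T^* T] have the same trace. *)
Lemma retrC S T : retr (S * T) = retr (T * S).
Proof.
have sq U : retr (star U * U) = retr (U * star U).
  by rewrite retr_starM -sqn_star_delta1 -retr_starM starK.
have := sq (star S + T); rewrite starD starK !mulrDl !mulrDr !retrD (sq T).
have -> : retr (star S * S) = retr (S * star S) := sq S.
have e1 : retr (star T * star S) = retr (S * T) by rewrite -starM retr_star.
have e2 : retr (star S * star T) = retr (T * S) by rewrite -starM retr_star.
by rewrite e1 e2 => ?; lra.
Qed.

End Adjoint.

(** * Weak limits and matrices over LG *)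

Lemma cvgn_sum (R : realType) (I : eqType) (s : seq I) (u : I -> nat -> R) (l : I -> R) :
  (forall i, i \in s -> u i n @[n --> \oo] --> l i) ->
  \sum_(i <- s) u i n @[n --> \oo] --> \sum_(i <- s) l i.
Proof.
elim: s => [_|i s IHs ul].
  rewrite big_nil; under eq_fun do rewrite big_nil; exact: cvg_cst.
rewrite big_cons; under eq_fun do rewrite big_cons.
apply: cvgD; first by apply: ul; rewrite mem_head.
by apply: IHs => j js; apply: ul; rewrite in_cons js orbT.
Qed.

Section WeakLimit.
Variables (R : realType) (G : groupType).
Local Notation l2 := (l2 R G).
Local Notation LG := (LG R G).
Variables (T : nat -> LG) (C : R).
Hypothesis C0 : 0 <= C.
Hypothesis T_bound : forall i f, sqn (T i f) <= C * sqn f.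
Hypothesis T_cvg : forall f x, cvgn (fun i => complex.Re (T i f x)).

Definition re_lim (f : l2) x : R := limn (fun i => complex.Re (T i f x)).

(** Since [Im z = - Re (i z)], convergence of real parts for all vectors is enough. *)
Definition lim_fun (f : l2) x : R[i] := (re_lim f x +i* - re_lim ('i%C *: f) x)%C.

Lemma cvg_re_lim f x : complex.Re (T i f x) @[i --> \oo] --> complex.Re (lim_fun f x).
Proof. exact: T_cvg. Qed.

Lemma cvg_im_lim f x : complex.Im (T i f x) @[i --> \oo] --> complex.Im (lim_fun f x).
Proof.
rewrite /=; have -> : (fun i => complex.Im (T i f x)) =
    (fun i => - complex.Re (T i ('i%C *: f) x)).
  apply/funext => i; rewrite LGZ l2_scaleE.
  by case: (T i f x) => a b /=; ring.
by apply: cvgN; exact: T_cvg.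
Qed.

Lemma lim_fun_sum f (A : {fset G}) : \sum_(x <- A) nsq (lim_fun f x) <= C * sqn f.
Proof.
have h : \sum_(x <- A) nsq (T i f x) @[i --> \oo] --> \sum_(x <- A) nsq (lim_fun f x).
  apply: cvgn_sum => x _; rewrite /nsq; under eq_fun do rewrite !expr2.
  rewrite !expr2; apply: cvgD; apply: cvgM; try exact: cvg_re_lim; exact: cvg_im_lim.
apply: (cvgr_to_le h); near=> i; exact: le_trans (sqn_ge_sum _ _) (T_bound _ _).
Unshelve. all: by end_near. Qed.

Fact lim_fun_l2 f : lim_fun f \in @l2_pred R G.
Proof.
apply/asboolP; apply: (@le_lt_trans _ _ (C * sqn f)%:E); last exact: ltry.
rewrite sqnormE; apply: ge_ereal_sup => _ [S [finS _] <-].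
by rewrite fsbig_finite//= sumEFin lee_fin lim_fun_sum.
Qed.

Definition lim_op f : l2 := L2 (lim_fun_l2 f).

Lemma lim_op_LG : is_LG lim_op.
Proof.
have uniq (u : nat -> R) (a b : R) : u @ \oo --> a -> u @ \oo --> b -> a = b.
  by move=> ua ub; rewrite -(cvg_lim (@Rhausdorff R) ua) (cvg_lim (@Rhausdorff R) ub).
have rex f x : complex.Re (T i f x) @[i --> \oo] --> complex.Re (lim_op f x).
  exact: cvg_re_lim.
have imx f x : complex.Im (T i f x) @[i --> \oo] --> complex.Im (lim_op f x).
  exact: cvg_im_lim.
have ext z w : complex.Re z = complex.Re w -> complex.Im z = complex.Im w -> z = w :> R[i].
  by case: z w => [a b] [c d] /= -> ->.
split=> [z f g||g f].
- have e i x : T i (z *: f + g) x = z * T i f x + T i g x by rewrite LG_linear.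
  apply: l2E => x; have -> : (z *: lim_op f + lim_op g) x = z * lim_op f x + lim_op g x by [].
  apply: ext.
  + apply: (uniq _ _ _ (rex _ x)); under eq_fun do rewrite e.
    have -> : complex.Re (z * lim_op f x + lim_op g x) =
      complex.Re z * complex.Re (lim_op f x) - complex.Im z * complex.Im (lim_op f x)
      + complex.Re (lim_op g x).
      by case: z {e} (lim_op f x) (lim_op g x) => [a b] [c d] [k j] /=.
    have -> : (fun i => complex.Re (z * T i f x + T i g x)) = fun i =>
      complex.Re z * complex.Re (T i f x) - complex.Im z * complex.Im (T i f x)
      + complex.Re (T i g x).
      by apply/funext => i; case: z {e} (T i f x) (T i g x) => [a b] [c d] [k j] /=.
    apply: cvgD (rex _ _); apply: cvgB; (apply: cvgM; first exact: cvg_cst) => //.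
  + apply: (uniq _ _ _ (imx _ x)); under eq_fun do rewrite e.
    have -> : complex.Im (z * lim_op f x + lim_op g x) =
      complex.Re z * complex.Im (lim_op f x) + complex.Im z * complex.Re (lim_op f x)
      + complex.Im (lim_op g x).
      by case: z {e} (lim_op f x) (lim_op g x) => [a b] [c d] [k j] /=.
    have -> : (fun i => complex.Im (z * T i f x + T i g x)) = fun i =>
      complex.Re z * complex.Im (T i f x) + complex.Im z * complex.Re (T i f x)
      + complex.Im (T i g x).
      by apply/funext => i; case: z {e} (T i f x) (T i g x) => [a b] [c d] [k j] /=.
    apply: cvgD (imx _ _); apply: cvgD; (apply: cvgM; first exact: cvg_cst) => //.
- exists C => // f; rewrite -!sqnE -EFinM sqnE sqnormE.
  apply: ge_ereal_sup => _ [S [finS _] <-].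
  by rewrite fsbig_finite//= sumEFin lee_fin lim_fun_sum.
- apply: l2E => x; apply: ext.
  + apply: (uniq _ _ _ (rex _ x)); under eq_fun do rewrite LG_rr.
    exact: rex.
  + apply: (uniq _ _ _ (imx _ x)); under eq_fun do rewrite LG_rr.
    exact: imx.
Qed.

(** The uniform bound survives on finite sums of coordinates, hence in l2; linearity and
    equivariance pass to the limit coordinatewise. *)
Lemma LG_weak_limit : exists S : LG, forall f x,
  complex.Re (T i f x) @[i --> \oo] --> complex.Re (S f x).
Proof. by exists (mkLG (asboolT lim_op_LG)) => f x; exact: cvg_re_lim. Qed.

End WeakLimit.

(** * Matrices over LG acting on vectors of l2, their adjoints and traces *)

Section MatrixAction.
Variables (R : realType) (G : groupType).
Local Notation l2 := (l2 R G).
Local Notation LG := (LG R G).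

Lemma LG_sumE (I : Type) (s : seq I) (P : pred I) (F : I -> LG) (f : l2) :
  (\sum_(i <- s | P i) F i) f = \sum_(i <- s | P i) F i f.
Proof. exact: (big_morph (fun T : LG => T f)). Qed.

Definition mxv m n (W : 'M[LG]_(m, n)) (v : 'I_n -> l2) (i : 'I_m) : l2 :=
  \sum_j W i j (v j).

Definition vsqn n (v : 'I_n -> l2) : R := \sum_i sqn (v i).

Definition vip n (v w : 'I_n -> l2) : R := \sum_i ip (v i) (w i).

Definition adjmx m n (W : 'M[LG]_(m, n)) : 'M[LG]_(n, m) :=
  \matrix_(i, j) star (W j i).

Definition mxretr n (W : 'M[LG]_n) : R := \sum_i retr (W i i).

Definition vsingle n (k : 'I_n) (f : l2) (i : 'I_n) : l2 := if i == k then f else 0.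

Lemma mxvM m n p (A : 'M[LG]_(m, n)) (B : 'M[LG]_(n, p)) v :
  mxv (A *m B) v = mxv A (mxv B v).
Proof.
apply/funext => i; rewrite /mxv.
under eq_bigr do rewrite mxE LG_sumE.
by rewrite exchange_big; apply: eq_bigr => j _ /=; rewrite LG_sum.
Qed.

Lemma mxvDl m n (A B : 'M[LG]_(m, n)) v i : mxv (A + B) v i = mxv A v i + mxv B v i.
Proof. by rewrite /mxv -big_split; apply: eq_bigr => j _; rewrite mxE. Qed.

Lemma mxvN m n (A : 'M[LG]_(m, n)) v i : mxv (- A) v i = - mxv A v i.
Proof. by rewrite /mxv -sumrN; apply: eq_bigr => j _; rewrite mxE. Qed.

Lemma mxv1 n (v : 'I_n -> l2) : mxv 1%:M v = v.
Proof.
apply/funext => i; rewrite /mxv (bigD1 i)//= big1 ?addr0 => [|j ji].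
  by rewrite mxE eqxx.
by rewrite mxE eq_sym (negPf ji).
Qed.

Lemma mxvD m n (A : 'M[LG]_(m, n)) u v i :
  mxv A (fun j => u j + v j) i = mxv A u i + mxv A v i.
Proof. by rewrite /mxv -big_split; apply: eq_bigr => j _; rewrite LGD. Qed.

Lemma mxv_single m n (A : 'M[LG]_(m, n)) k f i : mxv A (vsingle k f) i = A i k f.
Proof.
rewrite /mxv (bigD1 k)//= big1 ?addr0 => [|j jk]; rewrite /vsingle ?eqxx//.
by rewrite (negPf jk) LG0.
Qed.

Lemma vsqn_ge0 n (v : 'I_n -> l2) : 0 <= vsqn v.
Proof. by apply: sumr_ge0 => i _; exact: sqn_ge0. Qed.

Lemma vsqn_ge n (v : 'I_n -> l2) i : sqn (v i) <= vsqn v.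
Proof.
by rewrite /vsqn (bigD1 i)//= lerDl sumr_ge0// => j _; exact: sqn_ge0.
Qed.

Lemma vsqn_single n (k : 'I_n) f : vsqn (vsingle k f) = sqn f.
Proof.
rewrite /vsqn (bigD1 k)//= big1 ?addr0 => [|j jk]; rewrite /vsingle ?eqxx//.
by rewrite (negPf jk) sqn0.
Qed.

Lemma vip_single n (v : 'I_n -> l2) k f : vip v (vsingle k f) = ip (v k) f.
Proof.
rewrite /vip (bigD1 k)//= big1 ?addr0 => [|j jk]; rewrite /vsingle ?eqxx//.
by rewrite (negPf jk) ip0r.
Qed.

Lemma vipvv n (v : 'I_n -> l2) : vip v v = vsqn v.
Proof. by apply: eq_bigr => i _; rewrite ipff. Qed.

Lemma vsqnD n (v w : 'I_n -> l2) :
  vsqn (fun i => v i + w i) = vsqn v + vsqn w + 2 * vip v w.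
Proof.
rewrite /vsqn /vip mulr_sumr -!big_split; apply: eq_bigr => i _ /=.
by rewrite sqnD.
Qed.

Lemma vsqnB n (v w : 'I_n -> l2) :
  vsqn (fun i => v i - w i) = vsqn v + vsqn w - 2 * vip v w.
Proof.
rewrite /vsqn /vip mulr_sumr -sumrN -!big_split; apply: eq_bigr => i _ /=.
by rewrite sqnB.
Qed.

Lemma vip_adjmx m n (W : 'M[LG]_(m, n)) v w : vip (mxv (adjmx W) v) w = vip v (mxv W w).
Proof.
have -> : vip (mxv (adjmx W) v) w = \sum_i \sum_j ip (v j) (W j i (w i)).
  apply: eq_bigr => i _; rewrite ipC /mxv ip_sumr; apply: eq_bigr => j _.
  by rewrite mxE ipC starP.
by rewrite exchange_big; apply: eq_bigr => j _; rewrite /mxv ip_sumr.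
Qed.

Lemma adjmxK m n (W : 'M[LG]_(m, n)) : adjmx (adjmx W) = W.
Proof. by apply/matrixP => i j; rewrite !mxE starK. Qed.

Lemma star_sum (I : Type) (s : seq I) (P : pred I) (F : I -> LG) :
  star (\sum_(i <- s | P i) F i) = \sum_(i <- s | P i) star (F i).
Proof. exact: (big_morph (@star R G) (@starD R G) (@star0 R G)). Qed.

Lemma adjmxM m n p (A : 'M[LG]_(m, n)) (B : 'M[LG]_(n, p)) :
  adjmx (A *m B) = adjmx B *m adjmx A.
Proof.
apply/matrixP => i j; rewrite !mxE star_sum; apply: eq_bigr => k _.
by rewrite !mxE starM.
Qed.

Lemma adjmxB m n (A B : 'M[LG]_(m, n)) : adjmx (A - B) = adjmx A - adjmx B.
Proof. by apply/matrixP => i j; rewrite !mxE starD starN. Qed.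

Lemma adjmx1 n : adjmx 1%:M = 1%:M :> 'M[LG]_n.
Proof.
apply/matrixP => i j; rewrite !mxE.
by case: (eqVneq i j) => _ /=; rewrite ?star1 ?star0.
Qed.

Lemma retr_sum (I : Type) (s : seq I) (P : pred I) (F : I -> LG) :
  retr (\sum_(i <- s | P i) F i) = \sum_(i <- s | P i) retr (F i).
Proof. exact: (big_morph (@retr R G) (@retrD R G) (@retr0 R G)). Qed.

Lemma mxretrC m n (A : 'M[LG]_(m, n)) (B : 'M[LG]_(n, m)) :
  mxretr (A *m B) = mxretr (B *m A).
Proof.
rewrite /mxretr; under eq_bigr do rewrite mxE retr_sum.
rewrite exchange_big; apply: eq_bigr => j _ /=.
by rewrite mxE retr_sum; apply: eq_bigr => i _; rewrite retrC.
Qed.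

Lemma mxretrD n (A B : 'M[LG]_n) : mxretr (A + B) = mxretr A + mxretr B.
Proof. by rewrite /mxretr -big_split; apply: eq_bigr => i _; rewrite mxE retrD. Qed.

Lemma mxretrN n (A : 'M[LG]_n) : mxretr (- A) = - mxretr A.
Proof. by rewrite /mxretr -sumrN; apply: eq_bigr => i _; rewrite mxE retrN. Qed.

Lemma mxretrB n (A B : 'M[LG]_n) : mxretr (A - B) = mxretr A - mxretr B.
Proof. by rewrite mxretrD mxretrN. Qed.

Lemma mxretr1 n : mxretr (1%:M : 'M[LG]_n) = n%:R.
Proof.
rewrite /mxretr (eq_bigr (fun=> 1)) => [|i _]; last by rewrite mxE eqxx retr1.
by rewrite sumr_const card_ord.
Qed.

Lemma mxretr_adjM m n (A : 'M[LG]_(m, n)) :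
  mxretr (adjmx A *m A) = \sum_k vsqn (mxv A (vsingle k (delta R 1%g))).
Proof.
apply: eq_bigr => k _; rewrite mxE retr_sum; apply: eq_bigr => j _.
by rewrite mxE retr_starM mxv_single.
Qed.

Definition contractive m n (W : 'M[LG]_(m, n)) :=
  forall v, vsqn (mxv W v) <= vsqn v.

(** With [w = W^* v], expanding [0 <= |v - W w|^2] gives [2 |w|^2 <= |v|^2 + |W w|^2], and
    [|W w|^2 <= |w|^2]. *)
Lemma contractive_adjmx m n (W : 'M[LG]_(m, n)) : contractive W -> contractive (adjmx W).
Proof.
move=> cW v; set w := mxv _ v.
have := vsqn_ge0 (fun i => v i - mxv W w i); rewrite vsqnB -vip_adjmx vipvv -/w.
by have := cW w => ? ?; lra.
Qed.

Definition defect m n (W : 'M[LG]_(m, n)) : 'M[LG]_m := 1%:M - W *m adjmx W.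

Lemma mxv_defect m n (W : 'M[LG]_(m, n)) v i :
  mxv (defect W) v i = v i - mxv W (mxv (adjmx W) v) i.
Proof. by rewrite mxvDl mxvN mxv1 mxvM. Qed.

(** The squared norm expands to [|v|^2 - 2 |W^* v|^2 + |W W^* v|^2], whose last term is at most
    [|W^* v|^2]. *)
Lemma vsqn_defect m n (W : 'M[LG]_(m, n)) v : contractive W ->
  vsqn (mxv (defect W) v) <= vsqn v - vsqn (mxv (adjmx W) v).
Proof.
move=> cW.
have -> : mxv (defect W) v = fun i => v i - mxv W (mxv (adjmx W) v) i.
  by apply/funext => i; rewrite mxv_defect.
rewrite vsqnB -vip_adjmx vipvv.
by have := cW (mxv (adjmx W) v) => ?; lra.
Qed.

Lemma contractive_defect m n (W : 'M[LG]_(m, n)) :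
  contractive W -> contractive (defect W).
Proof.
by move=> cW v; apply: (le_trans (vsqn_defect _ cW)); rewrite gerBl vsqn_ge0.
Qed.

Lemma adjmx_defect m n (W : 'M[LG]_(m, n)) : adjmx (defect W) = defect W.
Proof. by rewrite /defect adjmxB adjmx1 adjmxM adjmxK. Qed.

(** * Convergence of the powers of [1 - W W^*] for a contraction [W] *)

Section PowersOfDefect.
Variables (m n : nat) (W : 'M[LG]_(m, n)).
Hypothesis cW : contractive W.
Let X : 'M[LG]_m := defect W.

Lemma mxvXS i v : mxv (X ^+ i.+1) v = mxv X (mxv (X ^+ i) v).
Proof. by rewrite exprS -mulmxE mxvM. Qed.

Lemma mxvXD i j v : mxv (X ^+ (i + j)) v = mxv (X ^+ i) (mxv (X ^+ j) v).
Proof. by rewrite exprD -mulmxE mxvM. Qed.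

Lemma contractiveX i : contractive (X ^+ i).
Proof.
elim: i => [|i IHi] v; first by rewrite expr0 mxv1.
by rewrite mxvXS; apply: (le_trans (contractive_defect cW _)).
Qed.

Lemma adjmxX i : adjmx (X ^+ i) = X ^+ i.
Proof.
elim: i => [|i IHi]; first by rewrite expr0 adjmx1.
by rewrite exprS -mulmxE adjmxM IHi adjmx_defect mulmxE -exprSr exprS.
Qed.

Lemma vipXX i u v : vip (mxv (X ^+ (i + i)) u) v = vip (mxv (X ^+ i) u) (mxv (X ^+ i) v).
Proof. by rewrite -vip_adjmx adjmxX -mxvXD. Qed.

Lemma cvgn_vsqnX v : cvgn (fun i => vsqn (mxv (X ^+ i) v)).
Proof.
apply: nonincreasing_is_cvgn; last first.
  by exists 0 => _ [i _ <-]; exact: vsqn_ge0.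
apply/nonincreasing_seqP => i; rewrite mxvXS.
exact: contractive_defect cW _.
Qed.

(** Self-adjointness turns the even power into [<X^i u, X^i v>], and polarization reduces this to
    the nonincreasing sequences [|X^i v|^2]. *)
Lemma cvgn_vipX u v : cvgn (fun i => vip (mxv (X ^+ (i + i)) u) v).
Proof.
have -> : (fun i => vip (mxv (X ^+ (i + i)) u) v) = fun i =>
    (vsqn (mxv (X ^+ i) (fun j => u j + v j)) - vsqn (mxv (X ^+ i) u)
     - vsqn (mxv (X ^+ i) v)) * 2^-1.
  apply/funext => i; rewrite vipXX.
  have -> : mxv (X ^+ i) (fun j => u j + v j) =
      fun j => mxv (X ^+ i) u j + mxv (X ^+ i) v j.
    by apply/funext => j; rewrite mxvD.
  by rewrite vsqnD; field.
apply: is_cvgM; last exact: is_cvg_cst.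
by apply: is_cvgB; [apply: is_cvgB|]; exact: cvgn_vsqnX.
Qed.

Lemma entry_bound i j k f : sqn ((X ^+ i) j k f) <= sqn f.
Proof.
rewrite -(mxv_single (X ^+ i)) -[leRHS](vsqn_single k).
exact: le_trans (vsqn_ge _ _) (contractiveX _ _).
Qed.

Lemma entry_re i j k f x :
  complex.Re ((X ^+ i) j k f x) = vip (mxv (X ^+ i) (vsingle k f)) (vsingle j (delta R x)).
Proof. by rewrite vip_single mxv_single ip_delta. Qed.

Lemma defect_weak_limit : exists q : 'M[LG]_m, forall j k f x,
  complex.Re ((X ^+ (i + i)) j k f x) @[i --> \oo] --> complex.Re (q j k f x).
Proof.
have h jk : exists T : LG, forall f x,
    complex.Re ((X ^+ (i + i)) jk.1 jk.2 f x) @[i --> \oo] --> complex.Re (T f x).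
  apply: (@LG_weak_limit _ _ (fun i => (X ^+ (i + i)) jk.1 jk.2) 1 ler01) => [i f|f x].
    by rewrite mul1r entry_bound.
  under eq_fun do rewrite entry_re; exact: cvgn_vipX.
have [q qP] := choice h; exists (\matrix_(j, k) q (j, k)) => j k f x.
by rewrite mxE; exact: qP (j, k) f x.
Qed.

(** The quantities [a j = |W^* X^j v|^2] decrease and have sum at most [|v|^2], because passing from
    [X^j v] to its image under [X] loses at least [a j] of squared norm. *)
Lemma vsqn_adjmx_X i v : i.+1%:R * vsqn (mxv (adjmx W) (mxv (X ^+ i) v)) <= vsqn v.
Proof.
pose a i := vsqn (mxv (adjmx W) (mxv (X ^+ i) v)).
have swap u : mxv (adjmx W) (mxv X u) = mxv (defect (adjmx W)) (mxv (adjmx W) u).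
  rewrite -!mxvM; congr mxv.
  by rewrite /X /defect mulmxBr mulmxBl mulmx1 mul1mx adjmxK mulmxA.
have a_decr j : a j.+1 <= a j.
  rewrite /a mxvXS swap; apply: contractive_defect.
  exact: contractive_adjmx.
(* The squared norm that remains is kept in the estimate so that the induction closes. *)
suff : i.+1%:R * a i + vsqn (mxv (X ^+ i.+1) v) <= vsqn v.
  by apply: le_trans; rewrite lerDl vsqn_ge0.
elim: i => [|i IHi].
  rewrite mul1r /a mxvXS expr0 mxv1 addrC -lerBrDr.
  exact: vsqn_defect.
apply: le_trans IHi; rewrite (mxvXS i.+1).
have := vsqn_defect (mxv (X ^+ i.+1) v) cW; rewrite -/X -/(a i.+1) => h.
have : i.+1%:R * a i.+1 <= i.+1%:R * a i by rewrite ler_wpM2l.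
rewrite -[i.+2]addn1 natrD mulrDl mul1r => ?; lra.
Qed.

(** The entry is adjoint to one of [W^* X^(2i)], which sends a delta function to a vector of squared
    norm at most [1 / (i + 1)]; Cauchy-Schwarz transfers the estimate. *)
Lemma cvgn_XW j l f x :
  complex.Re ((X ^+ (i + i) *m W) j l f x) @[i --> \oo] --> (0 : R).
Proof.
have bnd i : complex.Re ((X ^+ (i + i) *m W) j l f x) ^+ 2 <= harmonic i * sqn f.
  have -> : (X ^+ (i + i) *m W) j l = star ((adjmx W *m X ^+ (i + i)) l j).
    by rewrite -{2}[X ^+ (i + i)]adjmxX -adjmxM [in RHS]mxE starK.
  rewrite -ip_delta starP mulrC; apply: le_trans (cauchy_schwarz _ _) _.
  rewrite ler_wpM2l ?sqn_ge0// -(mxv_single _ j (delta R x)).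
  apply: le_trans (vsqn_ge _ _) _.
  rewrite mxvM (_ : harmonic i = i.+1%:R^-1)// -div1r ler_pdivlMr ?ltr0n// mulrC.
  have := vsqn_adjmx_X (i + i) (vsingle j (delta R x)).
  rewrite vsqn_single -[delta R x]scale1r sqn_delta.
  have -> : nsq 1 = 1 :> R by rewrite /nsq /=; ring.
  rewrite scale1r; apply: le_trans; rewrite ler_wpM2r ?vsqn_ge0//.
  by rewrite ler_nat ltnS leq_addr.
have u0 : (harmonic i * sqn f)%R @[i --> \oo] --> (0 : R).
  by rewrite -[0](mul0r (sqn f)); apply: cvgM cvg_harmonic (cvg_cst _).
apply/cvgr0Pnorm_lt => e e0.
have := u0 => /cvgr0Pnorm_lt /(_ (e ^+ 2)); rewrite exprn_gt0// => /(_ isT).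
apply: filterS => i; rewrite ger0_norm ?mulr_ge0 ?sqn_ge0 ?invr_ge0// => lt.
rewrite -(ltr_pXn2r (n := 2))// ?nnegrE ?normr_ge0 ?ltW//.
by rewrite real_normK ?num_real// (le_lt_trans (bnd i)).
Qed.

(* [X^(2i)] converges weakly to a matrix over [LG] whose rows annihilate [W],
   hence also [S]. *)
Lemma defect_power_trace_small (S : 'M[LG]_m) :
  (forall z : 'rV[LG]_m, z *m W = 0 -> z *m S = 0) ->
  forall e : R, 0 < e -> exists i, `|mxretr (X ^+ (i + i) *m S)| < e.
Proof.
move=> WS e e0; have [q qP] := defect_weak_limit.
have mul_cvg p (B : 'M[LG]_(m, p)) j l f x :
    complex.Re ((X ^+ (i + i) *m B) j l f x) @[i --> \oo]
      --> complex.Re ((q *m B) j l f x).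
  have E (A : 'M[LG]_m) : complex.Re ((A *m B) j l f x) =
      \sum_k complex.Re (A j k (B k l f) x).
    rewrite mxE LG_sumE l2_sumE.
    by apply: (big_morph (@complex.Re R)) => // [[a b] [c d]].
  rewrite E; under eq_fun do rewrite E.
  by apply: cvgn_sum => k _; exact: qP.
have qW : q *m W = 0.
  apply/matrixP => j l; rewrite [RHS]mxE.
  have re0 f x : complex.Re ((q *m W) j l f x) = 0.
    have c0 := cvgn_XW j l f x.
    rewrite -(cvg_lim (@Rhausdorff R) (mul_cvg _ W j l f x)).
    exact: (cvg_lim (@Rhausdorff R) c0).
  apply: LGE => f; apply: l2E => x.
  (* Only real parts are known to vanish; using [i f] as well removes the imaginary parts. *)
  have := re0 ('i%C *: f) x; have := re0 f x; rewrite LGZ l2_scaleE.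
  case: ((q *m W) j l f x) => a b /= a0 h; have [-> ->//] : a = 0 /\ b = 0 by split; lra.
have qS : q *m S = 0.
  apply/row_matrixP => j; rewrite row_mul row0; apply: WS.
  by rewrite -row_mul qW row0.
have : mxretr (X ^+ (i + i) *m S) @[i --> \oo] --> (0 : R).
  have -> : 0 = mxretr (q *m S) :> R.
    by rewrite qS /mxretr big1// => j _; rewrite mxE retr0.
  by apply: cvgn_sum => j _; exact: mul_cvg.
move=> /cvgr_dist_lt /(_ e e0) [N _ /(_ N)]; rewrite /= leqnn => /(_ isT).
by rewrite sub0r normrN => lt; exists N.
Qed.

End PowersOfDefect.

End MatrixAction.

(** * Trace estimates for idempotent matrices over LG *)

Section TraceBound.
Variables (R : realType) (G : groupType).
Local Notation l2 := (l2 R G).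
Local Notation LG := (LG R G).

Lemma is_LG_homothety (r : R) : is_LG (fun f : l2 => r%:C%C *: f).
Proof.
split=> [z f g|| g f]; last by apply: l2E.
- by rewrite scalerDr !scalerA mulrC.
- exists (r ^+ 2) => [|f]; first exact: sqr_ge0.
  rewrite -!sqnE -EFinM lee_fin sqnZ.
  by have -> : nsq r%:C%C = r ^+ 2 by rewrite /nsq /=; ring.
Qed.

Definition homothety (r : R) : LG := mkLG (asboolT (is_LG_homothety r)).

Lemma homothetyM r s : homothety (r * s) = homothety r * homothety s.
Proof. by apply: LGE => f; rewrite /= scalerA -rmorphM. Qed.

Lemma homothety1 : homothety 1 = 1.
Proof. by apply: LGE => f; rewrite /= scale1r. Qed.

Lemma homothetyC r (T : LG) : homothety r * T = T * homothety r.
Proof. by apply: LGE => f; rewrite /= LGZ. Qed.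

Definition hmx n (r : R) : 'M[LG]_n := (homothety r)%:M.

Lemma hmxC m n r (A : 'M[LG]_(m, n)) : hmx m r *m A = A *m hmx n r.
Proof.
apply/matrixP => i j; rewrite !mxE (bigD1 i)//= [RHS](bigD1 j)//= !mxE !eqxx.
rewrite !big1 ?addr0 => [|k kj|k ki]; first by rewrite mulr1n homothetyC.
- by rewrite mxE (negPf kj) mulr0.
- by rewrite mxE eq_sym (negPf ki) mul0r.
Qed.

Lemma hmxV n r : r != 0 -> hmx n r *m hmx n r^-1 = 1%:M.
Proof.
by move=> r0; rewrite /hmx -scalar_mxM -homothetyM divff// homothety1.
Qed.

Lemma mulmx_hmx_eq0 m n r (A : 'M[LG]_(m, n)) : r != 0 -> A *m hmx n r = 0 -> A = 0.
Proof. by move=> r0 A0; rewrite -[A]mulmx1 -(hmxV n r0) mulmxA A0 mul0mx. Qed.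

Lemma adjmx_hmx n r : adjmx (hmx n r) = hmx n r.
Proof.
have sr : star (homothety r) = homothety r.
  by apply: LGE => f; apply: ip_ext => h; rewrite starP /= ipZl ipZr.
apply/matrixP => i j; rewrite !mxE.
by case: (eqVneq i j) => _ /=; rewrite ?sr ?star0.
Qed.

Lemma vsqn_hmx n r (v : 'I_n -> l2) : vsqn (mxv (hmx n r) v) = r ^+ 2 * vsqn v.
Proof.
have E i : mxv (hmx n r) v i = r%:C%C *: v i.
  rewrite /mxv (bigD1 i)//= big1 ?addr0 => [|j ji].
    by rewrite mxE eqxx.
  by rewrite mxE eq_sym (negPf ji).
rewrite /vsqn mulr_sumr; apply: eq_bigr => i _; rewrite E sqnZ.
by congr (_ * _); rewrite /nsq /=; ring.
Qed.

Lemma mxv_bounded m n (W : 'M[LG]_(m, n)) :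
  exists2 K : R, 0 <= K & forall v, vsqn (mxv W v) <= K * vsqn v.
Proof.
have row_bounded i (s : seq 'I_n) : exists2 K : R, 0 <= K &
    forall v, sqn (\sum_(j <- s) W i j (v j)) <= K * vsqn v.
  elim: s => [|j s [K K0 IHs]].
    by exists 0 => // v; rewrite big_nil sqn0 mul0r.
  have [C C0 WC] := LG_bound (W i j).
  exists (2 * C + 2 * K) => [|v]; first by rewrite addr_ge0 ?mulr_ge0.
  rewrite big_cons; set a := W i j (v j); set b := \sum_(k <- s) _.
  have := sqn_ge0 (a - b); rewrite sqnB sqnD => h.
  have ha : sqn a <= C * vsqn v.
    by apply: le_trans (WC _) _; rewrite ler_wpM2l ?vsqn_ge.
  by have := IHs v => hb; rewrite -/b in hb; lra.
suff [K K0 WK] : exists2 K : R, 0 <= K & forall v,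
    \sum_(i <- index_enum 'I_m) sqn (mxv W v i) <= K * vsqn v by exists K.
elim: (index_enum _) => [|i s [K K0 IHs]].
  by exists 0 => // v; rewrite big_nil mul0r.
have [C C0 WC] := row_bounded i (index_enum 'I_n).
exists (C + K) => [|v]; first exact: addr_ge0.
by rewrite big_cons mulrDl lerD ?IHs//; exact: WC.
Qed.

Lemma ex_contractive m n (W : 'M[LG]_(m, n)) :
  exists2 r : R, r != 0 & contractive (W *m hmx n r).
Proof.
have [K K0 WK] := mxv_bounded W.
have K1 : 0 < 1 + K by rewrite ltr_wpDr.
(* Squared norms get multiplied by at most [K / (1 + K)^2], which does not exceed 1. *)
exists (1 + K)^-1; first by rewrite invr_eq0 gt_eqF.
move=> v; rewrite mxvM; apply: le_trans (WK _) _; rewrite vsqn_hmx mulrA.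
rewrite -[leRHS]mul1r ler_wpM2r ?vsqn_ge0// exprVn ler_pdivrMr ?exprn_gt0//.
by rewrite mul1r sqrrD; have := sqr_ge0 K => ?; lra.
Qed.

(** This exact factorization through [W] replaces the fact that a range projection takes its values
    in the closure of the range. *)
Lemma defect_powerE m n (W : 'M[LG]_(m, n)) i :
  exists Q, 1%:M - defect W ^+ i = W *m Q.
Proof.
elim: i => [|i [Q IHi]].
  by exists 0; rewrite expr0 subrr mulmx0.
exists (Q + adjmx W *m defect W ^+ i).
rewrite mulmxDr -IHi mulmxA exprS -mulmxE mulmxBl mul1mx.
by rewrite opprB addrA addrAC.
Qed.

Lemma mulmx_defect_power m n (W : 'M[LG]_(m, n)) i :
  adjmx W *m defect W ^+ i = defect (adjmx W) ^+ i *m adjmx W.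
Proof.
elim: i => [|i IHi]; first by rewrite !expr0 mulmx1 mul1mx.
rewrite [in LHS]exprSr [in RHS]exprSr -!mulmxE mulmxA IHi -!mulmxA; congr (_ *m _).
by rewrite /defect mulmxBr mulmxBl mulmx1 mul1mx adjmxK mulmxA.
Qed.

(** A finite stage of the equality of the ranks of [W] and its adjoint: by cyclicity of the trace,
    the differences between consecutive powers agree on both sides. *)
Lemma mxretr_defect_power m n (W : 'M[LG]_(m, n)) i :
  mxretr (defect W ^+ i) - m%:R = mxretr (defect (adjmx W) ^+ i) - n%:R.
Proof.
elim: i => [|i IHi]; first by rewrite !expr0 !mxretr1 !subrr.
have step p q (V : 'M[LG]_(p, q)) : mxretr (defect V ^+ i.+1) =
    mxretr (defect V ^+ i) - mxretr (defect V ^+ i *m V *m adjmx V).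
  by rewrite exprSr -mulmxE {2}/defect mulmxBr mulmx1 mxretrB mulmxA.
rewrite !step mxretrC mulmxA mulmx_defect_power adjmxK.
by move: IHi => /=; set x := mxretr (defect W ^+ i) => ?; lra.
Qed.

(** Each even power is split into two self-adjoint halves, which makes the trace a sum of squared
    norms; positivity and monotonicity follow. *)
Lemma mxretr_powerM m n p (W : 'M[LG]_(m, n)) (V : 'M[LG]_(m, p)) i j :
  mxretr (defect W ^+ (i + i) *m defect V ^+ (j + j)) =
  \sum_k vsqn (mxv (defect W ^+ i) (mxv (defect V ^+ j) (vsingle k (delta R 1%g)))).
Proof.
under eq_bigr do rewrite -mxvM.
rewrite -mxretr_adjM adjmxM !adjmxX !exprD -!mulmxE.
by rewrite mulmxA mxretrC !mulmxA.
Qed.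

Lemma mxretr_powerM_le m n p (W : 'M[LG]_(m, n)) (V : 'M[LG]_(m, p)) i j :
  contractive W ->
  mxretr (defect W ^+ (i + i) *m defect V ^+ (j + j)) <= mxretr (defect V ^+ (j + j)).
Proof.
move=> cW; have -> : mxretr (defect V ^+ (j + j)) =
    mxretr (adjmx (defect V ^+ j) *m defect V ^+ j).
  by rewrite adjmxX exprD mulmxE.
rewrite mxretr_powerM mxretr_adjM; apply: ler_sum => k _.
exact: contractiveX.
Qed.

Lemma mxretr_powerM_ge0 m n p (W : 'M[LG]_(m, n)) (V : 'M[LG]_(m, p)) i j :
  0 <= mxretr (defect W ^+ (i + i) *m defect V ^+ (j + j)).
Proof. by rewrite mxretr_powerM sumr_ge0// => k _; exact: vsqn_ge0. Qed.

(* The von Neumann rank of [W] is at most [n - 1], because [W] kills [c], and the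
   range of [E] lies in the closure of the range of [W].  Range projections are
   replaced by [1 - (1 - V V^* )^(2i)] for contractive multiples [V] of
   [W], [E], [c]. *)
Lemma idempotent_trace_le m n (W : 'M[LG]_(m, n)) (c : 'cV[LG]_n) (E : 'M[LG]_m) :
  E *m E = E ->
  (forall z : 'rV[LG]_m, z *m W = 0 -> z *m E = 0) ->
  W *m c = 0 ->
  (forall z : 'rV[LG]_1, z *m adjmx c = 0 -> z = 0) ->
  mxretr E <= n%:R - 1.
Proof.
move=> EE WE Wc c_inj; apply/ler_addgt0Pr => e e0.
have e3 : 0 < e / 3 by rewrite divr_gt0.
have [r r0 cWr] := ex_contractive W; set W' := W *m hmx n r in cWr.
have [s s0 cEs] := ex_contractive E; set E' := E *m hmx m s in cEs.
have [t t0 cct] := ex_contractive c; set c' := c *m hmx 1 t in cct.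
have W'c' : W' *m c' = 0.
  by rewrite /W' /c' -mulmxA hmxC !mulmxA Wc !mul0mx.
(* [j] is chosen before [i]: the factor [Q] depends on [j], and [i] is adapted to [Q]. *)
have [j jE] : exists j, `|mxretr (defect E' ^+ (j + j) *m E)| < e / 3.
  apply: defect_power_trace_small => // z; rewrite /E' mulmxA.
  exact: mulmx_hmx_eq0.
have [Q QE] := defect_powerE E' (j + j).
have [i iW] : exists i, `|mxretr (defect W' ^+ (i + i) *m (E' *m Q))| < e / 3.
  apply: defect_power_trace_small => // z; rewrite /W' mulmxA => /(mulmx_hmx_eq0 r0)/WE zE.
  by rewrite /E' !mulmxA zE !mul0mx.
(* Injectivity of multiplication by [adjmx c] means that [c] has full rank 1, so some power of its 1
   by 1 defect has small trace. *)
have [l lc] : exists l, `|mxretr (defect (adjmx c') ^+ (l + l) *m 1%:M)| < e / 3.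
  apply: defect_power_trace_small => // [|z]; first exact: contractive_adjmx.
  rewrite /c' adjmxM adjmx_hmx mulmxA => /c_inj /(mulmx_hmx_eq0 t0) ->.
  by rewrite mul0mx.
(* [1 - E] kills [E'] from the left, and [1 - defect E' ^+ (j + j)] factors through [E']; only the
   small term separates the trace from [m - tr E]. *)
have trE : mxretr (defect E' ^+ (j + j)) =
    m%:R - mxretr E + mxretr (defect E' ^+ (j + j) *m E).
  have -> : m%:R - mxretr E = mxretr (defect E' ^+ (j + j) *m (1%:M - E)).
    rewrite mxretrC -[defect E' ^+ _](subKr 1%:M) QE mulmxBr mulmx1 /E' !mulmxA.
    by rewrite mulmxBl mul1mx EE subrr !mul0mx subr0 mxretrB mxretr1.
  by rewrite mulmxBr mulmx1 mxretrB subrK.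
have trW : mxretr (defect W' ^+ (i + i)) =
    mxretr (defect W' ^+ (i + i) *m defect E' ^+ (j + j)) +
    mxretr (defect W' ^+ (i + i) *m (E' *m Q)).
  by rewrite -QE mulmxBr mulmx1 mxretrB addrC subrK.
have leW := mxretr_powerM_le E' i j cWr.
have swW := mxretr_defect_power W' (i + i).
have swc := mxretr_defect_power c' (l + l).
have [P PE] := defect_powerE c' (l + l).
(* As [W' c' = 0], these powers fix the range of [c']; this is the source of the 1 subtracted from
   [n]. *)
have fixc k : defect (adjmx W') ^+ k *m c' = c'.
  elim: k => [|k IHk]; first by rewrite expr0 mul1mx.
  by rewrite exprS -mulmxE -mulmxA IHk mulmxBl mul1mx adjmxK -mulmxA W'c' mulmx0 subr0.
have trc : mxretr (defect (adjmx W') ^+ (i + i)) =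
    mxretr (defect (adjmx W') ^+ (i + i) *m defect c' ^+ (l + l)) +
    (n%:R - mxretr (defect c' ^+ (l + l))).
  rewrite -(mxretr1 R G) -mxretrB PE -{2}(fixc (i + i)%N) -mulmxA -PE.
  by rewrite mulmxBr mulmx1 mxretrB addrC subrK.
have gec := mxretr_powerM_ge0 (adjmx W') c' i l.
move: lc; rewrite mulmx1 !ltr_norml in jE iW * => /andP[_ lc].
case/andP: jE => _ jE; case/andP: iW => _ iW.
rewrite -[1%:R]/1 in swc.
(* Up to three errors below [e / 3], the chain is [1 <= tr (defect (adjmx W')^(2i)) = tr (defect
   W'^(2i)) + n - m <= n - tr E]. *)
lra.
Qed.

End TraceBound.

(** * Fox calculus *)

Section GroupRing.
Variables (R : realType) (G : groupType).
Local Notation l2 := (l2 R G).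
Local Notation LG := (LG R G).
Local Notation ZG := (fchain G int).
Implicit Types (c d : ZG).

Definition zg c : LG := \sum_(g \in [set: G]) lam R g *~ c g.

Lemma zgE c (S : {fset G}) : [set g | c g != 0] `<=` [set` S] ->
  zg c = \sum_(g <- S) lam R g *~ c g.
Proof. by apply: (@fsum_fset _ _ _ (fun g n => lam R g *~ n)). Qed.

Lemma zg0 : zg 0 = 0.
Proof.
by rewrite (@zgE _ fset0) ?big_seq_fset0// => g /=; rewrite eqxx.
Qed.

Lemma zgD c d : zg (c + d) = zg c + zg d.
Proof.
pose S := fset_set ([set x | c x != 0] `|` [set x | d x != 0]).
have fS : [set` S] = [set x | c x != 0] `|` [set x | d x != 0].
  by rewrite fset_setK// finite_setU; split; exact: fchain_finite.
rewrite !(@zgE _ S) ?fS//.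
- by rewrite -big_split; apply: eq_bigr => g _; rewrite /= -mulrzDr.
- move=> x /=; rewrite fctE.
  by have [->|] := eqVneq (c x) 0; [rewrite add0r; right|left].
Qed.

Lemma zgN c : zg (- c) = - zg c.
Proof. by apply: (addrI (zg c)); rewrite -zgD !subrr zg0. Qed.

Lemma zg_single g n : zg (fsingle g n) = lam R g *~ n.
Proof.
rewrite (@zgE _ [fset g]%fset) ?big_seq_fset1 /= ?eqxx//.
by move=> h /=; case: (h =P g) => [->|_]; rewrite ?eqxx// inE.
Qed.

Lemma ZG_actE c f : ZG_act c f = zg c f.
Proof.
have fS : [set` fset_set [set x | c x != 0]] = [set x | c x != 0].
  by rewrite fset_setK//; exact: fchain_finite.
rewrite (@zgE _ (fset_set [set x | c x != 0])) ?fS// LG_sumE.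
rewrite /ZG_act (@fsum_fset _ _ _ (fun g n => left_regular g f *~ n) _
  (fset_set [set x | c x != 0])) ?fS//.
apply: eq_bigr => g _; case: (c g) => m.
  by rewrite -!pmulrn; elim: m => [//|m IHm]; rewrite !mulrS IHm.
rewrite !NegzE !mulrNz -!pmulrn; congr (- _).
by elim: m.+1 => [//|{}m IHm]; rewrite !mulrS IHm.
Qed.

Fact zg_inv_subproof c : (fun g => c g^-1%g) \in @fin_supp G int.
Proof.
apply/asboolP; have fc := finite_image (fun g : G => g^-1%g) (fchain_finite c).
by apply: sub_finite_set fc => g /= cg; exists g^-1%g; rewrite ?invgK.
Qed.

(** The involution of the group ring; integer coefficients need no conjugation. *)
Definition zg_inv c : ZG := FChain (zg_inv_subproof c).

Lemma star_zg c : star (zg c) = zg (zg_inv c).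
Proof.
have fS : [set` fset_set [set x | c x != 0]] = [set x | c x != 0].
  by rewrite fset_setK//; exact: fchain_finite.
have -> : zg (zg_inv c) = \sum_(g \in [set: G]) lam R g^-1%g *~ c g.
  have bij : bijective (fun g : G => g^-1%g).
    by exists (fun g : G => g^-1%g) => g; rewrite invgK.
  rewrite [LHS](reindex_fsbigT _ (fun g => lam R g *~ zg_inv c g) bij).
  by apply: eq_fsbigr => g _ /=; rewrite invgK.
rewrite (@fsum_fset _ _ _ (fun g n => lam R g^-1%g *~ n) c
  (fset_set [set x | c x != 0])) ?fS//.
rewrite (@zgE c (fset_set [set x | c x != 0])) ?fS// star_sum.
apply: eq_bigr => g _; rewrite -star_lam.
have starM m T : star (T *+ m) = star T *+ m :> LG.
  by elim: m => [|m IHm]; rewrite ?mulr0n ?star0// !mulrS starD IHm.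
case: (c g) => m; first by rewrite -!pmulrn starM.
by rewrite !NegzE !mulrNz starN -!pmulrn starM.
Qed.

(* The hypothesis concerns left multiplication; for right multiplication one
   passes to adjoints. *)
Lemma mulr_zg_eq0 c (y : LG) : 
  (forall x : ZG, x != 0 -> injective (@ZG_act R G x)) ->
  c != 0 -> y * zg c = 0 -> y = 0.
Proof.
move=> inj c0 yc; rewrite -[y]starK; suff -> : star y = 0 by rewrite star0.
have d0 : zg_inv c != 0.
  apply: contra_neq c0 => d0; apply: fchainE => g.
  by have := congr1 (fun d : ZG => d g^-1%g) d0; rewrite /= invgK.
apply: LGE => f; apply: (inj _ d0); rewrite !ZG_actE -star_zg LG0.
have e : star (zg c) * star y = 0 by rewrite -starM yc star0.
exact: (congr1 (fun T : LG => T f) e).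
Qed.

End GroupRing.

(** * Relations between group elements and their Fox derivatives *)

Section Words.
Variables (G : groupType) (X : choiceType) (b : X -> G).
Local Notation ZG := (fchain G int).

Lemma word_eval_cat u v : word_eval b (u ++ v) = (word_eval b u * word_eval b v)%g.
Proof. by rewrite /word_eval big_cat. Qed.

Lemma word_eval_cons l u : word_eval b (l :: u) = (letter_eval b l * word_eval b u)%g.
Proof. by rewrite /word_eval big_cons. Qed.

Lemma word_eval_nil : word_eval b [::] = 1%g.
Proof. by rewrite /word_eval big_nil. Qed.

Lemma letter_eval_inv l : letter_eval b (letter_inv l) = (letter_eval b l)^-1%g.
Proof. by case: l => x [] /=; rewrite /letter_eval /= ?invgK. Qed.

Lemma word_eval_inv u : word_eval b (word_inv u) = (word_eval b u)^-1%g.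
Proof.
elim: u => [|l u IHu]; first by rewrite word_eval_nil invg1.
rewrite -cat1s word_inv_cat !word_eval_cat IHu invgM; congr (_ * _)%g.
by rewrite /word_eval /word_inv !big_seq1 letter_eval_inv.
Qed.

Lemma subgroup_gen_wordP g :
  subgroup_gen (range b) g <-> exists u, g = word_eval b u.
Proof.
split=> [gen|[u ->] H [[H1 HM HV] bH]]; last first.
  elim: u => [|[x e] u IHu]; first by rewrite word_eval_nil.
  rewrite word_eval_cons; apply: HM => //.
  have Hx : H (b x) by apply: bH; exists x.
  by case: e; rewrite /letter_eval /=; [|apply: HV].
apply: (gen [set h | exists u, h = word_eval b u]); split; last first.
  by move=> _ [x _ <-]; exists [:: (x, true)]; rewrite /word_eval big_seq1.
split=> [|_ _ [u ->] [v ->]|_ [u ->]].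
- by exists [::]; rewrite word_eval_nil.
- by exists (u ++ v); rewrite word_eval_cat.
- by exists (word_inv u); rewrite word_eval_inv.
Qed.

Lemma not_free_relation : ~ is_group_iso_onto (free_lift b) (subgroup_gen (range b)) ->
  exists w, word_eval b w = 1%g /\ ~ word_equiv w [::].
Proof.
move=> notiso; apply/not_existsP => norel; apply: notiso; split.
  exact: free_liftM.
split=> [x _|x y _ _ xy|g /subgroup_gen_wordP[u ->]].
- by apply/subgroup_gen_wordP; exists (repr x).
- pose z := (x * y^-1)%g.
  have z1 : free_lift b z = 1%g.
    by apply: (mulIg (free_lift b y)); rewrite -free_liftM mulgVK mul1g.
  have := norel (repr z); rewrite not_andP => -[//|/contrapT /free_piP].
  by rewrite reprK -/(free_one X) => e; rewrite -[x](mulgVK y) -/z e mul1g.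
- by exists (\pi_(free_group X) u)%qT => //; rewrite free_lift_pi.
Qed.

(* The Fox derivative of [u] with respect to [x], multiplied by [g]. *)
Fixpoint fox (x : X) (g : G) (u : word X) : ZG :=
  if u is l :: v then
    (if l.1 == x then
       if l.2 then fsingle g 1 else - fsingle (g * (b x)^-1)%g 1
     else 0) + fox x (g * letter_eval b l)%g v
  else 0.

(** In the Cayley graph, a coefficient at [h] comes from an edge labelled [x] with source [h] on the
    path of [u] from [g]. The source is reached before a positive letter and after a negative
    one. *)
Lemma fox_split x g u h : fox x g u h != 0 -> exists u1 l u2,
  [/\ u = u1 ++ l :: u2, l.1 = x &
      h = (g * (if l.2 then word_eval b u1 else word_eval b (u1 ++ [:: l])))%g].
Proof.
elim: u g => [|l v IHv] g /=; first by case/eqP.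
have [fv|/IHv[u1 [l' [u2 [-> l'x ->]]]] _] :=
    eqVneq (fox x (g * letter_eval b l)%g v h) 0; last first.
  exists (l :: u1), l', u2; split=> //.
  by case: ifP => _; rewrite ?cat_cons word_eval_cons mulgA.
rewrite fctE fv addr0 => nz; exists [::], l, v; split=> //.
  by move: nz; case: (l.1 =P x) => // _; case/eqP.
move: nz; case: (l.1 =P x) => [lx|_]; last by case/eqP.
rewrite word_eval_nil /word_eval big_seq1 /letter_eval lx.
case: (l.2) => nz.
  by move: nz => /=; case: (h =P g) => [->|_]; rewrite ?mulg1// eqxx.
have {}nz : - (if h == (g * (b x)^-1)%g then 1 else 0 : int) != 0 by exact: nz.
by move: nz; case: (h =P _) => // _; rewrite oppr0 eqxx.
Qed.

(* A relation of minimal length is a simple cycle in the Cayley graph, so that its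
   first edge is not cancelled in the Fox derivative. *)
Lemma fox_neq0 w : word_eval b w = 1%g -> ~ word_equiv w [::] ->
  (forall u, (size u < size w)%N -> word_eval b u = 1%g -> word_equiv u [::]) ->
  exists x, fox x 1%g w != 0.
Proof.
case: w => [_ /(_ (word_equiv_refl _))//|l w] w1 wn minw.
(* A proper nonempty subword of value 1 and its complement are both shorter relations, hence trivial
   in the free group, which would make [l :: w] trivial too. *)
have sub u v s : l :: w = u ++ v ++ s -> word_eval b v = 1%g -> v <> [::] ->
    u ++ s <> [::] -> False.
  move=> e v1 vn usn.
  have szw : size (l :: w) = (size u + size v + size s)%N by rewrite e !size_cat addnA.
  have v_gt0 : (0 < size v)%N by case: (v) vn.
  have us_gt0 : (0 < size u + size s)%N by rewrite -size_cat; case: (u ++ s) usn.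
  have vE : word_equiv v [::] by apply: minw => //; rewrite szw; lia.
  have us1 : word_eval b (u ++ s) = 1%g.
    by move: w1; rewrite e !word_eval_cat v1 mul1g.
  apply: wn; apply: word_equiv_trans (_ : word_equiv (u ++ s) [::]).
    by rewrite e -[u ++ s]/(u ++ [::] ++ s); exact: word_equiv_ctx.
  by apply: minw us1; rewrite szw size_cat; lia.
(* The path does not return along its first edge: a nonempty [u1] would be a proper relation. For
   empty [u1] the subword [l], [letter_inv l] is a proper relation or the whole word, which then
   cancels. *)
have cancel u1 u2 : w = u1 ++ letter_inv l :: u2 -> word_eval b u1 = 1%g -> False.
  case: u1 => [|l1 u1] e u11; last by apply: (sub [:: l] (l1 :: u1) (letter_inv l :: u2));
    rewrite ?e.
  case: u2 e => [|l2 u2] e.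
    apply: wn; rewrite e; exact: (word_equiv_cancel [::] l [::]).
  apply: (sub [::] [:: l; letter_inv l] (l2 :: u2)); rewrite ?e//.
  by rewrite /word_eval !big_cons big_nil letter_eval_inv mulg1 mulgV.
(* [g0] is the source of the first edge, which contributes 1 or -1 there. *)
exists l.1; pose g0 := if l.2 then 1%g else letter_eval b l.
apply/eqP; rewrite /= eqxx !mul1g => /(congr1 (fun c : ZG => c g0)).
suff tl0 : fox l.1 (letter_eval b l) w g0 = 0.
  move: tl0; set B := fox _ _ _ => tl0; set A := (X in X + B).
  have -> : (A + B) g0 = A g0 + B g0 by [].
  rewrite tl0 addr0 /A /g0 /letter_eval; case: (l.2) => e.
    by have := e : (if 1%g == 1%g :> G then 1 else 0 : int) = 0; rewrite eqxx.
  have := e : - (if (b l.1)^-1%g == (b l.1)^-1%g then 1 else 0 : int) = 0.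
  by rewrite eqxx.
apply: contrapT => /eqP /fox_split[u1 [l' [u2 [e l'x]]]].
rewrite /g0; move: l l' e l'x sub cancel {w1 wn minw g0}.
(* A second edge with the same label and source closes up a proper subword if its sign is that of
   the first edge, and backtracks along the first edge otherwise. *)
move=> [x []] [y []] e /= yx sub cancel; subst y.
- move=> h; apply: (sub [::] ((x, true) :: u1) ((x, true) :: u2)); rewrite ?e//.
  by rewrite word_eval_cons -h.
- rewrite word_eval_cat /word_eval big_seq1 {1 3}/letter_eval /= mulgA => h.
  apply: (cancel u1 u2 e); apply: (mulgI (b x)); apply: (mulIg (b x)^-1%g).
  by rewrite mulg1 mulgV -h.
- move=> h; apply: (cancel u1 u2 e); apply: (mulgI (letter_eval b (x, false))).
  by rewrite mulg1 -h.
- move=> h; apply: (sub [:: (x, false)] (u1 ++ [:: (x, false)]) u2).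
  + by rewrite e -catA.
  + by apply: (mulgI (letter_eval b (x, false))); rewrite mulg1 -h.
  + by case: (u1).
  + by [].
Qed.

Lemma ex_minimal_relation : (exists w, word_eval b w = 1%g /\ ~ word_equiv w [::]) ->
  exists w x, word_eval b w = 1%g /\ fox x 1%g w != 0.
Proof.
move=> [w0 [w01 w0n]].
pose P m := `[< exists w, [/\ size w = m, word_eval b w = 1%g & ~ word_equiv w [::]] >].
have exP : exists m, P m by exists (size w0); apply/asboolP; exists w0.
case: (ex_minnP exP) => m /asboolP[w [szw w1 wn]] minm.
have [|x wx] := fox_neq0 w1 wn; last by exists w, x.
move=> u; rewrite szw ltnNge => ltu u1; apply: contrapT => un.
by move/negP: ltu; apply; apply: minm; apply/asboolP; exists u.
Qed.

End Words.

(** * Chains of the bar complex modulo boundaries *)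

Section Chains.
Variables (R : realType) (G : groupType).
Local Notation LG := (LG R G).
Local Notation bar1 := (bar1 R G).

Definition bdry (c : bar1) : Prop := exists d, bar_d2 d = c.

Lemma bdry0 : bdry 0.
Proof. by exists 0; rewrite raddf0. Qed.

Lemma bdryD c d : bdry c -> bdry d -> bdry (c + d).
Proof. by move=> [x <-] [y <-]; exists (x + y); rewrite raddfD. Qed.

Lemma bdryN c : bdry c -> bdry (- c).
Proof. by move=> [x <-]; exists (- x); rewrite raddfN. Qed.

Lemma bdryZ (s : LG) c : bdry c -> bdry (s *: c).
Proof. by move=> [x <-]; exists (s *: x); rewrite linearZ. Qed.

Lemma bdry_sum (I : Type) (s : seq I) (F : I -> bar1) :
  (forall i, bdry (F i)) -> bdry (\sum_(i <- s) F i).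
Proof.
by move=> bF; apply: (big_ind bdry) => [||i _]; [exact: bdry0|exact: bdryD|exact: bF].
Qed.

Lemma bdry_cycle c : bdry c -> bar_d1 c = 0.
Proof. by move=> [d <-]; exact: bar_d1d2. Qed.

Definition bar_single (g : G) (s : LG) : bar1 := fsingle g (s : LG^o).

Lemma bar_singleD g s t : bar_single g (s + t) = bar_single g s + bar_single g t.
Proof.
apply: fchainE => h; rewrite [RHS](_ : _ = bar_single g s h + bar_single g t h)//=.
by case: ifP => _ //; rewrite addr0.
Qed.

Lemma bar_single0 g : bar_single g 0 = 0.
Proof. by apply: fchainE => h /=; case: ifP. Qed.

Lemma bar_singleN g s : bar_single g (- s) = - bar_single g s.
Proof. by apply: (addrI (bar_single g s)); rewrite -bar_singleD !subrr bar_single0. Qed.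

Lemma bar_singleZ g (t s : LG) : t *: bar_single g s = bar_single g (t * s).
Proof.
apply: fchainE => h; rewrite [LHS](_ : _ = t * bar_single g s h)//=.
by case: ifP => _ //; rewrite mulr0.
Qed.

Lemma bar_d2_single (p : G * G) (s : LG) : bar_d2 (fsingle p (s : LG^o)) =
  bar_single p.2 (s * lam R p.1) - bar_single (p.1 * p.2)%g s + bar_single p.1 s.
Proof.
rewrite /bar_d2 (@fsum_fset _ _ _ (fun p m => bar_single p.2 (m * lam R p.1)
    - bar_single (p.1 * p.2)%g m + bar_single p.1 m) _ [fset p]%fset).
- by rewrite big_seq_fset1 /= eqxx.
- by move=> q; rewrite mul0r !bar_single0 subrr addr0.
- by move=> q /=; case: (q =P p) => [->|_]; rewrite ?eqxx// inE.
Qed.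

Lemma bdry_mul (g h : G) s :
  bdry (bar_single h (s * lam R g) - bar_single (g * h)%g s + bar_single g s).
Proof. by exists (fsingle (g, h) (s : LG^o)); exact: bar_d2_single. Qed.

Lemma bdry_one s : bdry (bar_single 1%g s).
Proof. by have := bdry_mul 1%g 1%g s; rewrite lam1 mulr1 mulg1 subrr add0r. Qed.

Lemma bdry_inv (g : G) s : bdry (bar_single g^-1%g s + bar_single g (s * lam R g^-1%g)).
Proof.
have := bdryD (bdry_mul g^-1%g g s) (bdry_one s).
by rewrite mulVg addrAC subrK addrC.
Qed.

(* [bdry_mul] says that [g h] = [g] + g [h] modulo boundaries; the Fox derivatives
   are the coefficients obtained by expanding a word in this way. *)
Lemma fox_chain (X : finType) (b : X -> G) (u : word X) (g : G) (s : LG) :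
  bdry (bar_single (word_eval b u) (s * lam R g) -
        \sum_x bar_single (b x) (s * zg R (fox b x g u))).
Proof.
elim: u g => [|l v IHv] g.
  rewrite word_eval_nil big1 ?subr0 => [|x _]; first exact: bdry_one.
  by rewrite zg0 mulr0 bar_single0.
rewrite word_eval_cons.
set m := s * lam R g; set L := letter_eval b l; set V := word_eval b v.
pose P x := if l.1 == x then
  if l.2 then fsingle g 1 else - fsingle (g * (b x)^-1)%g 1 else 0 : fchain G int.
have letterP : bdry (bar_single L m - \sum_x bar_single (b x) (s * zg R (P x))).
  rewrite (bigD1 l.1)//= big1 ?addr0 => [|x xl]; last first.
    by rewrite /P eq_sym (negPf xl) zg0 mulr0 bar_single0.
  rewrite /P eqxx /L /letter_eval; case: (l.2).
    by rewrite zg_single mulr1z subrr; exact: bdry0.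
  rewrite zgN zg_single mulr1z mulrN bar_singleN opprK lamM mulrA.
  exact: bdry_inv.
have -> : \sum_x bar_single (b x) (s * zg R (fox b x g (l :: v))) =
    \sum_x bar_single (b x) (s * zg R (P x)) +
    \sum_x bar_single (b x) (s * zg R (fox b x (g * L)%g v)).
  by rewrite -big_split; apply: eq_bigr => x _; rewrite /= zgD mulrDr bar_singleD.
have IH := IHv (g * L)%g; rewrite lamM mulrA -/m -/V in IH.
have := bdryD (bdryN (bdry_mul L V m)) (bdryD IH letterP).
congr bdry; rewrite [X in - X](_ : _ =
    bar_single V (m * lam R L) + bar_single L m - bar_single (L * V)%g m).
  by rewrite opprB [X in _ + X]addrACA -opprD subrKA (addrC (\sum_x _)).
by rewrite addrAC.
Qed.

Section Generators.
Variables (n : nat) (a : 'I_n -> G).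
Hypothesis a_gen : forall g, exists u, g = word_eval a u.

Definition gen_chain (r : 'rV[LG]_n) : bar1 := \sum_j bar_single (a j) (r 0 j).

Lemma gen_chainD r t : gen_chain (r + t) = gen_chain r + gen_chain t.
Proof.
by rewrite /gen_chain -big_split; apply: eq_bigr => j _; rewrite mxE bar_singleD.
Qed.

Lemma gen_chain0 : gen_chain 0 = 0.
Proof. by rewrite /gen_chain big1// => j _; rewrite mxE bar_single0. Qed.

Lemma gen_chainN r : gen_chain (- r) = - gen_chain r.
Proof. by apply: (addrI (gen_chain r)); rewrite -gen_chainD !subrr gen_chain0. Qed.

Lemma gen_chainZ s r : gen_chain (s *: r) = s *: gen_chain r.
Proof.
by rewrite /gen_chain scaler_sumr; apply: eq_bigr => j _; rewrite mxE bar_singleZ.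
Qed.

(** Multiplication by this column is the boundary map in the coordinates of [gen_chain]. *)
Definition augm : 'cV[LG]_n := \col_j (lam R (a j) - 1).

Lemma bar_d1_ch r : bar_d1 (gen_chain r) = (r *m augm) 0 0.
Proof.
rewrite raddf_sum mxE; apply: eq_bigr => j _.
by rewrite mxE mulrBr mulr1 [LHS]bar_d1_single.
Qed.

Lemma bdry_augm r : bdry (gen_chain r) -> r *m augm = 0.
Proof.
move=> /bdry_cycle; rewrite bar_d1_ch => e.
by apply/matrixP => i j; rewrite !ord1 e mxE.
Qed.

(** Each group element is a word in the generators, whose chain [fox_chain] expands; finite support
    reduces the general case to this one. *)
Lemma chain_ch (c : bar1) : exists r, bdry (c - gen_chain r).
Proof.
have single g s : exists r, bdry (bar_single g s - gen_chain r).
  have [u ->] := a_gen g.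
  exists (\row_j (s * zg R (fox a j 1%g u))).
  have := fox_chain a u 1%g s; rewrite lam1 mulr1 /gen_chain.
  by under [in X in _ -> X]eq_bigr do rewrite mxE.
have cE : c = \sum_(g <- fset_set [set g | c g != 0]) bar_single g (c g).
  have fS : [set` fset_set [set x | c x != 0]] = [set x | c x != 0].
    by rewrite fset_setK//; exact: fchain_finite.
  set A := fset_set _ in fS *; apply: fchainE => h.
  rewrite (big_morph (fun d : bar1 => d h) (id1 := 0) (op1 := +%R))//.
  have -> : \sum_(g <- A) bar_single g (c g) h = \sum_(g <- A) if h == g then c g else 0 by [].
  have [hA|hA] := boolP (h \in A).
    rewrite (big_fsetD1 h)//= eqxx big_seq big1 ?addr0// => g.
    by rewrite !inE eq_sym => /andP[/negPf->].
  have [->|chn0] := eqVneq (c h) 0.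
    rewrite big_seq big1// => g gA; case: (h =P g) => // hg.
    by rewrite hg gA in hA.
  have : [set` A] h by rewrite fS.
  by rewrite /= (negPf hA).
rewrite cE; elim: (enum_fset _) => [|g s [r rs]].
  by exists 0; rewrite big_nil gen_chain0 subr0; exact: bdry0.
have [t tg] := single g (c g); exists (t + r).
by rewrite big_cons gen_chainD opprD addrACA; exact: bdryD.
Qed.

(* Each row is a relation between [k.+1] of the generators not eliminated so far,
   which makes the matrix triangular with nonzero divisors on the diagonal. *)
Lemma relation_matrix (k : nat) :
  (forall x : fchain G int, x != 0 -> injective (@ZG_act R G x)) ->
  (forall i : 'I_k.+1 -> 'I_n, injective i -> exists w x,
    word_eval (a \o i) w = 1%g /\ fox (a \o i) x 1%g w != 0) ->
  forall m (S : {set 'I_n}), (m <= #|S| - k)%N ->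
  exists F : 'M[LG]_(m, n), [/\
    forall y : 'rV_m, bdry (gen_chain (y *m F)),
    forall t j, j \notin S -> F t j = 0 &
    forall y : 'rV_m, y *m F = 0 -> y = 0].
Proof.
move=> inj rel; elim=> [|m IHm] S mS.
  exists 0; split=> [y|[]//|y _]; last by rewrite thinmx0.
  by rewrite mulmx0 gen_chain0; exact: bdry0.
have kS : (k.+1 <= #|S|)%N by lia.
pose i (t : 'I_k.+1) : 'I_n := enum_val (widen_ord kS t).
have i_inj : injective i.
  by move=> t u /enum_val_inj /(congr1 val) /= tu; apply: val_inj.
have iS t : i t \in S by exact: enum_valP.
have [w [x [w1 wx]]] := rel i i_inj.
(* The Fox derivatives of the relation, placed in the columns [i t]; each sum has at most one term
   because [i] is injective. *)
pose f : 'rV[LG]_n := \row_j \sum_(t | i t == j) zg R (fox (a \o i) t 1%g w).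
have fi t : f 0 (i t) = zg R (fox (a \o i) t 1%g w).
  rewrite mxE (big_pred1 t)// => u /=.
  by rewrite (inj_eq i_inj).
have f_bdry s : bdry (gen_chain (s *: f)).
  (* The relation has value 1, so its own chain is a boundary, and so is its Fox expansion. *)
  have := bdryN (fox_chain (a \o i) w 1%g s); rewrite lam1 mulr1 w1 opprB => h.
  have := bdryD h (bdry_one s); rewrite subrK.
  congr bdry; rewrite /gen_chain (partition_big i xpredT)//=; apply: eq_bigr => j _.
  rewrite !mxE mulr_sumr.
  rewrite (big_morph (bar_single (a j)) (bar_singleD (a j)) (bar_single0 (a j))).
  by apply: eq_bigr => t /eqP <-.
(* Removing the column [i x] of a nonzero Fox derivative makes all rows of [F] vanish there. *)
have mS' : (m <= #|S :\ i x| - k)%N.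
  by move: mS; rewrite (cardsD1 (i x) S) iS add1n; move: #|_| => s; lia.
have [F [F_bdry F_supp F_inj]] := IHm _ mS'.
suff [F' F'P] : exists F' : 'M[LG]_(1 + m, n), [/\
    forall y : 'rV_(1 + m), bdry (gen_chain (y *m F')),
    forall t j, j \notin S -> F' t j = 0 &
    forall y : 'rV_(1 + m), y *m F' = 0 -> y = 0] by exists F'.
exists (col_mx f F); split=> [y|t j jS|y].
- rewrite -[y]hsubmxK mul_row_col gen_chainD; apply: bdryD; last exact: F_bdry.
  by rewrite [lsubmx _]mx11_scalar mul_scalar_mx.
- rewrite mxE; case: splitP => u _.
    rewrite ord1 mxE big_pred0// => v; apply/eqP => ij.
    by rewrite -ij iS in jS.
  by apply: F_supp; rewrite !inE (negPf jS) andbF.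
- rewrite -[y]hsubmxK mul_row_col => yF.
  (* Column [i x] sees only the new row, and its entry there is a nonzerodivisor. *)
  have y0 : lsubmx y = 0.
    have := congr1 (fun M : 'rV[LG]_n => M 0 (i x)) yF.
    rewrite !mxE big_ord_recl big_ord0 addr0 big1 ?addr0 => [|t _]; last first.
      by rewrite F_supp ?mulr0// !inE eqxx.
    rewrite ord1 fi => e; rewrite [lsubmx _]mx11_scalar.
    rewrite [X in X%:M](mulr_zg_eq0 inj wx e).
    by apply/matrixP => p q; rewrite !mxE mul0rn.
  by move: yF; rewrite y0 mul0mx add0r => /F_inj ->; rewrite row_mx0.
Qed.

End Generators.
End Chains.

(** * Coordinates for projective submodules of the first homology *)

Section Presentation.
Local Open Scope quotient_scope.
Variables (R : realType) (G : groupType).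
Local Notation LG := (LG R G).
Local Notation quot := (quotmod (@boundary1_pred R G)).

Lemma pi_bdry (x : cycle1 R G) : \pi_quot x = 0 :> quot <-> bdry (cycle1_val x).
Proof.
have pi0 : \pi_quot 0 = 0 :> quot.
  by apply: (addrI (\pi_quot 0)); rewrite -quotmod_piD !addr0.
rewrite -pi0 quotmod_piP subr0; split=> [/asboolP//|bx].
exact/asboolP.
Qed.

Lemma pi_comb (n : nat) (w : 'rV[LG]_n) (z : 'I_n -> cycle1 R G) :
  \sum_i w 0 i *: (\pi_quot (z i) : quot) = \pi_quot (\sum_i w 0 i *: z i).
Proof.
have pi0 : \pi_quot 0 = 0 :> quot by apply/pi_bdry; exact: bdry0.
rewrite (big_morph (fun x => \pi_quot x : quot) (@quotmod_piD _ _ _) pi0).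
by apply: eq_bigr => i _; exact: quotmod_scale_pi.
Qed.

(* Row [i] of [B] holds the coefficients, over the generators [a], of a cycle
   representing the image of row [i] of [A]. *)
Lemma projective_coordinates (n : nat) (a : 'I_n -> G) (P : set (H1 R G)) (r : R) :
  (forall g, exists u, g = word_eval a u) -> fg_projective_dim P r ->
  exists N (A : 'M[LG]_N) (B : 'M[LG]_(N, n)),
    [/\ A *m A = A, A *m B = B, B *m augm R a = 0,
        forall v : 'rV_N, bdry (gen_chain a (v *m B)) -> v *m A = 0
      & mxretr A = r].
Proof.
move=> a_gen [N [A [phi [AA phi_bij trA]]]].
pose z i : cycle1 R G := repr (phi (row i A)).
have zE i : phi (row i A) = \pi_quot (z i) by rewrite /z reprK.
have [b bP] := choice (fun i => chain_ch a_gen (cycle1_val (z i))).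
pose B0 : 'M[LG]_(N, n) := \matrix_(i, j) b i 0 j.
have B0E i : row i B0 = b i by apply/rowP => j; rewrite !mxE.
(* The coefficient matrix is multiplied by the idempotent to make [A] fix it. *)
exists N, A, (A *m B0); split=> //; first by rewrite mulmxA AA.
- rewrite -mulmxA; suff -> : B0 *m augm R a = 0 by rewrite mulmx0.
  apply/row_matrixP => i; rewrite row_mul B0E row0.
  have := bdry_cycle (bP i); rewrite raddfB /=.
  have -> : bar_d1 (cycle1_val (z i)) = 0 by case: (z i) => c /= /eqP.
  rewrite sub0r => /eqP; rewrite oppr_eq0 bar_d1_ch => /eqP e.
  by apply/matrixP => p q; rewrite !ord1 e mxE.
- move=> v; rewrite mulmxA; set w := v *m A => bw.
  have wA : w *m A = w by rewrite /w -mulmxA AA.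
  have val_sum : cycle1_val (\sum_i w 0 i *: z i) = \sum_i w 0 i *: cycle1_val (z i).
    rewrite (big_morph (@cycle1_val R G) (id1 := 0) (op1 := +%R))//.
  (* [phi w] is the class of the combination of the [z i] with coefficients [w], which differs by a
     boundary from a chain that is itself a boundary. *)
  have phiw : phi w = 0.
    rewrite -wA mulmx_sum_row linear_sum.
    have -> : \sum_i phi (w 0 i *: row i A) = \sum_i w 0 i *: (\pi_quot (z i) : quot).
      by apply: eq_bigr => i _; rewrite linearZ /= zE.
    rewrite pi_comb; apply/pi_bdry; rewrite val_sum.
    have := bdryD (bdry_sum (index_enum 'I_N)
      (fun i => bdryZ (w 0 i) (bP i))) bw.
    congr bdry; rewrite mulmx_sum_row (big_morph _ (gen_chainD a) (gen_chain0 R a)) -big_split.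
    by apply: eq_bigr => i _; rewrite /= B0E gen_chainZ -scalerDr subrK.
  have [_ phi_inj _] := phi_bij.
  apply: phi_inj; [by apply/mem_set; exists v| |by rewrite phiw linear0].
  by apply/mem_set; exists 0 => //; rewrite mul0mx.
- have := congr1 (@complex.Re R) trA => /= <-.
  by rewrite (big_morph (@complex.Re R) (id1 := 0) (op1 := +%R))// => -[? ?] [? ?].
Qed.

(** The adjoint of [a_j - 1] is the image of [a_j^-1 - 1], a nonzero element of the group ring. *)
Lemma augm_inj (n : nat) (a : 'I_n -> G) j :
  (forall x : fchain G int, x != 0 -> injective (@ZG_act R G x)) -> a j <> 1%g ->
  forall z : 'rV[LG]_1, z *m adjmx (augm R a) = 0 -> z = 0.
Proof.
move=> inj aj z /(congr1 (fun M : 'rV[LG]_n => M 0 j)).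
rewrite !mxE big_ord1 !mxE starD starN star1 star_lam => e.
pose c : fchain G int := fsingle (a j)^-1%g 1 - fsingle 1%g 1.
have cE : zg R c = lam R (a j)^-1%g - 1.
  by rewrite zgD zgN !zg_single !mulr1z lam1.
have c0 : c != 0.
  apply/eqP => /(congr1 (fun c : fchain G int => c 1%g)) c0.
  have {}c0 : (if 1%g == (a j)^-1%g then 1 else 0) -
      (if 1%g == 1%g :> G then 1 else 0) = 0 :> int by exact: c0.
  move: c0; rewrite eqxx; case: (1%g =P (a j)^-1%g) => // a1.
  by case: aj; rewrite -[a j]invgK -a1 invg1.
rewrite -cE in e; apply/matrixP => p q.
by rewrite !ord1 (mulr_zg_eq0 inj c0 e) mxE.
Qed.

Lemma mxretr_block (m p : nat) (A : 'M[LG]_m) (D : 'M[LG]_p) :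
  mxretr (block_mx A 0 0 D) = mxretr A + mxretr D.
Proof.
rewrite /mxretr big_split_ord; congr (_ + _); apply: eq_bigr => i _.
  by rewrite block_mxEul.
by rewrite block_mxEdr.
Qed.

End Presentation.

(** * The dimension bound and the free generators *)

Section Main.
Variables (R : realType) (G : groupType) (n k : nat) (a : 'I_n -> G).
Local Notation LG := (LG R G).
Hypothesis ZG_injective : forall x : fchain G int, x != 0 -> injective (@ZG_act R G x).
Hypothesis relations : forall i : 'I_k.+1 -> 'I_n, injective i ->
  exists w x, word_eval (a \o i) w = 1%g /\ fox (a \o i) x 1%g w != 0.

(** [idempotent_trace_le] is applied to the rows of [B] and [F] together, with an identity block
    added to [A]; it gives [tr A + (n - k) <= n - 1]. *)
Lemma trace_le_of_relations N (A : 'M[LG]_N) (B : 'M[LG]_(N, n)) j :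
  a j <> 1%g -> A *m A = A -> A *m B = B -> B *m augm R a = 0 ->
  (forall v : 'rV_N, bdry (gen_chain a (v *m B)) -> v *m A = 0) ->
  mxretr A <= k%:R - 1.
Proof.
move=> aj AA AB Ba Abd.
have [|F [F_bdry _ F_inj]] :=
    relation_matrix ZG_injective relations (m := n - k) (S := [set: 'I_n]).
  by rewrite cardsT card_ord.
have : mxretr (block_mx A 0 0 1%:M : 'M_(N + (n - k))) <= n%:R - 1.
  apply: (@idempotent_trace_le _ _ _ _ (col_mx B F) (augm R a)).
  - by rewrite mulmx_block !mulmx0 !mul0mx !addr0 !add0r AA mulmx1.
  (* If [x B + y F = 0], the chain of [x B] is a boundary, so [x A = 0]. Then [x B = x A B = 0], and
     [y = 0] by injectivity of [F]. *)
  - move=> z; rewrite -[z]hsubmxK mul_row_col mul_row_block !mulmx0 addr0 add0r mulmx1.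
    set x := lsubmx z; set y := rsubmx z => xy.
    have xA : x *m A = 0.
      apply: Abd; have -> : x *m B = - (y *m F) by apply/eqP; rewrite -addr_eq0 xy.
      by rewrite gen_chainN; exact: bdryN.
    have xB : x *m B = 0 by rewrite -AB mulmxA xA mul0mx.
    by rewrite xA (F_inj y) ?row_mx0//; move: xy; rewrite xB add0r.
  - rewrite mul_col_mx Ba; suff -> : F *m augm R a = 0 by rewrite col_mx0.
    apply/row_matrixP => t; rewrite row_mul row0; apply: bdry_augm.
    by rewrite rowE; exact: F_bdry.
  - exact: augm_inj ZG_injective aj.
rewrite mxretr_block mxretr1.
(* Subtraction is truncated, so only an inequality is available when [n < k]. *)
have : n%:R <= (n - k)%:R + k%:R :> R by rewrite -natrD ler_nat; lia.
by move=> ? ?; lra.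
Qed.

End Main.

(** A ceiling is at least [k + 1] only if the number exceeds [k], and the dimension is a supremum
    over projective submodules. *)
Lemma l2betti1_gt (R : realType) (G : groupType) (k : nat) :
  (k.+1%:R%:E <= eceil (l2betti1 R G))%E ->
  exists (P : set (H1 R G)) (r : R), fg_projective_dim P r /\ k%:R < r.
Proof.
move=> kb; have : (k%:R%:E < l2betti1 R G)%E.
  move: kb; rewrite /eceil; case: (l2betti1 R G) => [r| |] //=; last by rewrite ltry.
  rewrite lee_fin lte_fin => kr.
  have : (k%:Z < Num.ceil r)%R.
    by rewrite -(ltr_int R) (lt_le_trans _ kr)// ltr_nat.
  by rewrite ceil_gt_int.
move=> /ereal_sup_gt[_ [r [P Pr] <-]]; rewrite lte_fin => kr.
by exists P, r.
Qed.

(** In the trivial group no element generates freely, so the case [k = 0] asks for a nontrivial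
    group; for positive [k] the Betti number excludes it. *)
Theorem corollary4p7 (R : realType) (G : groupType)
    (G_countable : countable [set: G])
    (G_torsion_free : torsion_free G)
    (ZG_injective : forall x : fchain G int, x != 0 ->
       injective (@ZG_act R G x))
    (n : nat) (a : 'I_n -> G)
    (a_generate : subgroup_gen (range a) = [set: G])
    (k : nat)
    (G_nontrivial : k = 0%N -> exists g : G, g <> 1%g)
    (betti_ge_k : (k%:R%:E <= eceil (l2betti1 R G))%E) :
  exists i : 'I_k.+1 -> 'I_n,
    injective i /\
    is_group_iso_onto (free_lift (a \o i)) (subgroup_gen (range (a \o i))).
Proof.
apply: contrapT => not_free.
have a_gen g : exists u, g = word_eval a u.
  by apply/subgroup_gen_wordP; rewrite a_generate.
have rel (i : 'I_k.+1 -> 'I_n) : injective i -> exists w x,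
    word_eval (a \o i) w = 1%g /\ fox (a \o i) x 1%g w != 0.
  move=> i_inj; apply/ex_minimal_relation/not_free_relation => iso.
  by apply: not_free; exists i.
have [N [A [B [AA AB Ba Abd trA]]]] : exists N (A : 'M[LG R G]_N) (B : 'M[LG R G]_(N, n)),
    [/\ A *m A = A, A *m B = B, B *m augm R a = 0,
        forall v : 'rV_N, bdry (gen_chain a (v *m B)) -> v *m A = 0
      & k%:R - 1 < mxretr A].
  case: k betti_ge_k {G_nontrivial not_free rel} => [_|k'].
    (* For [k = 0] the empty idempotent serves: its trace 0 already exceeds -1. *)
    exists 0%N, 0, 0; split=> [|||v _|]; rewrite ?mul0mx ?mulmx0//.
    by rewrite /mxretr big_ord0; lra.
  move=> /l2betti1_gt[P [r [/(projective_coordinates a_gen)]]].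
  move=> [N [A [B [AA AB Ba Abd <-]]]] kr.
  by exists N, A, B; split=> //; rewrite -natr1 addrK.
have [aj|a1] := pselect (exists j, a j <> 1%g).
  case: aj => j aj.
  have := trace_le_of_relations ZG_injective rel aj AA AB Ba Abd.
  by rewrite leNgt trA.
have a_one j : a j = 1%g by apply: contrapT => aj; apply: a1; exists j.
(* If all generators are trivial, every [gen_chain] is a boundary, so [A] vanishes; trace 0 leaves
   only [k = 0], where nontriviality of the group is contradicted. *)
have A0 : A = 0.
  apply/row_matrixP => i; rewrite rowE row0; apply: Abd.
  by rewrite /gen_chain; apply: bdry_sum => j; rewrite a_one; exact: bdry_one.
have k0 : k = 0%N.
  move: trA; rewrite A0 /mxretr big1 => [|i _]; last by rewrite mxE retr0.
  by case: (k) => [//|k']; rewrite -natr1 addrK ltNge ler0n.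
have [g g1] := G_nontrivial k0; apply: g1; have [u ->] := a_gen g.
elim: u => [|[j e] u IHu]; first exact: word_eval_nil.
by rewrite word_eval_cons IHu /letter_eval a_one; case: e => /=; rewrite ?invg1 mulg1.
Qed.
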